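(* Let $P(x)$ be a symmetric polynomial in $x_1,\dots,x_n$ with coefficients in $\mathbb{F}(\beta,a)$, and let $g_\mu^\nu=g_\mu^\nu(P)$ ($\mu,\nu$ partitions of length at most $n$) be the coefficients defined by $P(x)G_\mu(x|a)=\sum_\nu g_\mu^\nu\,G_\nu(x|a)$. These satisfy the recurrence (for $\mu\neq\nu$) $$g_{\mu}^{\nu}=\frac{1}{\Pi(a_{\nu})-\Pi(a_{\mu})}\Big(\sum_{\mu\rightrightarrows^*\lambda}\Pi(a_{\mu})\beta^{|\lambda/\mu|}g_{\lambda}^{\nu}-\sum_{\eta\rightrightarrows^*\nu}\Pi(a_{\eta})\beta^{|\nu/\eta|}g_{\mu}^{\eta}\Big)$$ with boundary conditions $g_\mu^\nu=0$ unless $\mu\subset\nu$, and $g_\lambda^\lambda=P(a_\lambda)$. The general solution to this recurrence with these boundary conditions is $$g_\mu^\nu=\beta^{|\nu/\mu|}\sum_R\Pi(\rho_0)\Pi(\rho_1)\cdots\Pi(\rho_{l-1})\sum_{k=0}^{l}P(a_{\rho_k})\prod_{\substack{i=0\\ i\ne k}}^{l}\frac{1}{\Pi(\rho_k)-\Pi(\rho_i)},$$ where $\Pi(\rho)$ denotes $\Pi(a_\rho)$ and the outer sum is over all sequences of partitions (of arbitrary length $l\ge0$) $$R:\ \mu=\rho_0\rightrightarrows^*\rho_1\rightrightarrows^*\cdots\rightrightarrows^*\rho_{l-1}\rightrightarrows^*\rho_l=\nu$$ (the empty sum being $0$).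
   Context: Fix a positive integer $n$, a field $\mathbb{F}$, an indeterminate $\beta$, variables $x=(x_1,\dots,x_n)$ and a sequence of variables $a=(a_k)_{k\ge1}$. Put $x\oplus y=x+y+\beta xy$ and $\ominus x=\frac{-x}{1+\beta x}$. All partitions have at most $n$ parts and are padded with zeros to length $n$; a partition is identified with its Young diagram (box $(i,j)$ in row $i$, column $j$), $|\cdot|$ counts boxes, $\subset$ is containment of diagrams, $c(i,j)=j-i$. A set-valued $\lambda$-tableau $T$ assigns to each box $\alpha$ a non-empty $T(\alpha)\subset\{1,\dots,n\}$ such that $\max T(\alpha)\le\min T(\alpha')$ if $\alpha$ is immediately left of $\alpha'$, and $\max T(\alpha)<\min T(\alpha')$ if $\alpha$ is immediately above $\alpha'$; $|T|=\sum_\alpha|T(\alpha)|$. The factorial Grothendieck polynomial is $G_\lambda(x|a)=\sum_T\beta^{|T|-|\lambda|}\prod_{\alpha\in\lambda,\,r\in T(\alpha)}(x_r\oplus a_{r+c(\alpha)})$. The $G_\lambda(x|a)$ with $\ell(\lambda)\le n$ form a basis of the symmetric polynomials in $x_1,\dots,x_n$ over $\mathbb{F}(\beta,a)$. For a partition $\lambda$, $a_\lambda=((a_\lambda)_1,\dots,(a_\lambda)_n)$ with $(a_\lambda)_i=\ominus a_{n+1-i+\lambda_i}$. For $y=(y_1,\dots,y_n)$, $\Pi(y)=\prod_{i=1}^n(1+\beta y_i)$. Write $\lambda\rightrightarrows\mu$ if $\lambda\subset\mu$ and $\mu/\lambda$ has all its boxes in different rows and different columns ($\lambda=\mu$ allowed),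 and $\lambda\rightrightarrows^*\mu$ if moreover $\lambda\ne\mu$. *)

(* Defs.v *)
From HB Require Import structures.
From mathcomp Require Import all_boot all_order all_algebra.
From mathcomp Require Import finmap.
From mathcomp Require Import monalg.
From mathcomp Require Import mpoly.

Set Implicit Arguments.
Unset Strict Implicit.
Unset Printing Implicit Defensive.

Import GRing.Theory.

Local Open Scope ring_scope.

(* monalg has a notation of the same name, for another type. *)
Notation "{ 'mpoly' T [ n ] }" := (mpoly.mpoly n T) : type_scope.

Local Notation mcoef := monalg.mcoeff.
Local Notation supp := monalg.msupp.

(** The polynomial ring F[beta, a_1, a_2, ...] in countably many variables:
    variable 0 is beta and variable k is a_k, for k >= 1. *)
Definition coefring (F : fieldType) : Type := {malg F[{cmonom nat}]}.

Section CoefRing.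

Variable F : fieldType.

HB.instance Definition _ := GRing.ComNzRing.on (coefring F).

Implicit Types (p q : {malg F[{cmonom nat}]}) (m : {cmonom nat}).

(* Setting the variables N, N + 1, ... to 1 is a ring morphism to
   {mpoly F[N]}, injective on polynomials in the variables below N. *)

Definition trunc_exp N m : 'X_{1..N}%type :=
  [multinom (cmonom_val m (i : nat)) | i < N].

Definition trunc_monom N m : {mpoly F[N]} := 'X_[trunc_exp N m].

Fact trunc_monom_mmorphism N : monalg.mmorphism (trunc_monom N).
Proof.
split=> [m1 m2|]; rewrite /trunc_monom.
  rewrite -mpolyXD; congr 'X_[_]; apply/mnmP => i.
  by rewrite mnmDE !mnmE monalg.cmM.
rewrite -mpolyX0; congr 'X_[_]; apply/mnmP => i.
by rewrite mnmE mnm0E monalg.cm1.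
Qed.

HB.instance Definition _ N :=
  monalg.isMultiplicative.Build {cmonom nat} {mpoly F[N]} (trunc_monom N)
    (trunc_monom_mmorphism N).

Definition trunc N : {malg F[{cmonom nat}]} -> {mpoly F[N]} :=
  monalg.mmap (@mpolyC N F) (trunc_monom N).

HB.instance Definition _ N := GRing.RMorphism.on (trunc N).

Definition below N m := forall i, (N <= i)%N -> cmonom_val m i = 0%N.
Definition pbelow N p := forall m, m \in supp p -> below N m.

Lemma trunc_exp_inj N m1 m2 :
  below N m1 -> below N m2 -> trunc_exp N m1 = trunc_exp N m2 -> m1 = m2.
Proof.
move=> b1 b2 /mnmP e; apply/eqP/monalg.cmP => i.
case: (ltnP i N) => [lt_iN | le_Ni]; last by rewrite b1 ?b2.
by have := e (Ordinal lt_iN); rewrite !mnmE.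
Qed.

Lemma mcoeff_trunc N p m :
  pbelow N p -> below N m -> (trunc N p)@_(trunc_exp N m) = mcoef m p.
Proof.
move=> bp bm; rewrite /trunc monalg.mmapE raddf_sum /=.
rewrite [RHS](_ : _ = \sum_(k <- supp p) mcoef k p * (k == m)%:R).
  rewrite !big_seq; apply: eq_bigr => k kp.
  rewrite mcoeffCM mcoeffX; congr (_ * (nat_of_bool _)%:R).
  apply/eqP/eqP => [|-> //]; apply: trunc_exp_inj => //; exact: bp.
case: (boolP (m \in supp p)) => [mp | mNp].
  rewrite (big_rem m mp) /= eqxx mulr1 big1_seq ?addr0 // => k /andP [_].
  rewrite mem_rem_uniq ?fset_uniq // => /andP [/negbTE /= -> _].
  by rewrite mulr0.
rewrite monalg.mcoeff_outdom // big1_seq // => k /andP[_ kp].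
by case: eqP => [e | _]; rewrite ?mulr0 //; rewrite -e kp in mNp.
Qed.

Lemma ex_below p q : exists N, pbelow N p /\ pbelow N q.
Proof.
pose b m := (\max_(i <- finsupp (cmonom_val m)) i.+1)%N.
pose c p := (\max_(m <- supp p) b m)%N.
have bP r N : (c r <= N)%N -> pbelow N r.
  move=> le_cN m mr i le_Ni; apply/eqP; apply/negPn/negP => nz.
  have: (i.+1 <= N)%N.
    apply: leq_trans le_cN; apply: leq_trans (_ : b m <= _)%N.
      by apply: leq_bigmax_seq; rewrite // -monalg.cmE_neq0.
    exact: leq_bigmax_seq.
  by rewrite ltnNge le_Ni.
by exists (maxn (c p) (c q)); split; apply: bP; rewrite ?leq_maxl ?leq_maxr.
Qed.

Lemma trunc_eq0 N p : pbelow N p -> trunc N p = 0 -> p = 0.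
Proof.
move=> bp tp0; apply/eqP; rewrite -monalg.msupp_eq0; apply/eqP/fsetP => m.
rewrite in_fset0; apply/negP => mp.
have := mcoeff_trunc bp (bp _ mp); rewrite tp0 mcoeff0 => /esym/eqP.
by apply/negP; rewrite monalg.mcoeff_neq0.
Qed.

Definition coefring_unit : pred (coefring F) :=
  fun p => (p == malgC (mcoef mone p)) && (mcoef mone p != 0).

Definition coefring_inv p : coefring F :=
  if p \in coefring_unit then malgC (mcoef mone p)^-1 else p.

Fact coefring_mulVp : {in coefring_unit, left_inverse 1 coefring_inv *%R}.
Proof.
move=> p Up; rewrite /coefring_inv Up; case/andP: Up => /eqP {3}-> nz.
by rewrite -[_ * _]monalg.mpolyCM mulVf.
Qed.

Fact coefring_intro_unit p q : q * p = 1 -> p \in coefring_unit.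
Proof.
move=> qp1; have [N [bp bq]] := ex_below p q.
have : trunc N q * trunc N p = 1 by rewrite -rmorphM /= [_ * _]qp1 rmorph1.
move=> /mpoly_intro_unit /andP [/eqP tp _].
have pC : p = malgC (mcoef mone p).
  apply/monalg.malgP => m; rewrite monalg.mcoeffC.
  have [-> | nz_m] := eqVneq m mone; first by rewrite mulr1n.
  case: (boolP (m \in supp p)) => [mp | /monalg.mcoeff_outdom -> //].
  rewrite -(mcoeff_trunc bp (bp m mp)) tp mcoeffC; case: eqP => [e | _].
    case/eqP: nz_m; apply: (@trunc_exp_inj N); first exact: bp.
      by move=> i _; rewrite monalg.cm1.
    by rewrite e; apply/mnmP => i; rewrite mnm0E mnmE monalg.cm1.
  by rewrite mulr0.
apply/andP; split; first by rewrite -pC.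
apply/negP => /eqP p0; move: qp1; rewrite pC p0 monalg.malgC0E mulr0.
by move/eqP; rewrite eq_sym oner_eq0.
Qed.

Fact coefring_inv_out : {in [predC coefring_unit], coefring_inv =1 id}.
Proof. by rewrite /coefring_inv => p /negbTE /= ->. Qed.

HB.instance Definition _ := GRing.ComNzRing_hasMulInverse.Build (coefring F)
  coefring_mulVp coefring_intro_unit coefring_inv_out.

Fact coefring_idomain p q : p * q = 0 -> (p == 0) || (q == 0).
Proof.
move=> pq0; have [N [bp bq]] := ex_below p q.
have : trunc N p * trunc N q = 0 by rewrite -rmorphM /= [_ * _]pq0 rmorph0.
move/eqP; rewrite mulf_eq0 => /orP [] /eqP /trunc_eq0 -> //.
  by rewrite eqxx.
by rewrite eqxx orbT.
Qed.

HB.instance Definition _ :=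
  GRing.ComUnitRing_isIntegral.Build (coefring F) coefring_idomain.

End CoefRing.

Definition ratfun (F : fieldType) : fieldType := {fraction coefring F}.

Section RatFun.

Variable F : fieldType.

Definition ratvar (k : nat) : ratfun F := FracField.tofrac (<< ucm k >> : coefring F).

Definition betavar : ratfun F := ratvar 0.

(* The variables a_k are indexed by k >= 1; [avar 0] is [betavar], a junk value
   which is never used. *)
Definition avar (k : nat) : ratfun F := ratvar k.

End RatFun.

Arguments betavar {F}.
Arguments avar {F}.

Section Specialization.

(* Setting beta to 1, a_k to -1 and every other variable to 0. *)

Variables (F : fieldType) (k : nat).
Hypothesis k_gt0 : (0 < k)%N.

Let v (i : nat) : F := if i == 0%N then 1 else if i == k then -1 else 0.

Let h (m : {cmonom nat}) : F := \prod_(i <- finsupp (cmonom_val m)) v i ^+ cmonom_val m i.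

Let hE (d : {fset nat}) (m : {cmonom nat}) : (finsupp (cmonom_val m) `<=` d)%fset ->
  h m = \prod_(i <- d) v i ^+ cmonom_val m i.
Proof.
move=> sub; rewrite /h (big_fset_incl _ sub) // => i _.
by rewrite -monalg.cmE_neq0 negbK => /eqP ->.
Qed.

Fact special_mmorphism : monalg.mmorphism h.
Proof.
split=> [m1 m2|]; last by rewrite /h monalg.mdom1 big_seq_fset0.
rewrite (@hE _ m1 (fsubsetUl _ (finsupp (cmonom_val m2)))).
rewrite (@hE _ m2 (fsubsetUr (finsupp (cmonom_val m1)) _)).
rewrite /h monalg.mdomD -big_split /=.
by apply: eq_bigr => i _; rewrite monalg.cmM exprD.
Qed.

HB.instance Definition _ :=
  monalg.isMultiplicative.Build {cmonom nat} F h special_mmorphism.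

Definition special : coefring F -> F := monalg.mmap (@idfun F) h.

Fact special_zmod : zmod_morphism special.
Proof. exact: (@monalg.mmap_is_additive _ _ _ idfun h). Qed.

Fact special_monoid : monoid_morphism special.
Proof.
have [sM s1] := @monalg.mmap_is_multiplicative _ _ _ idfun h.
by split; [exact: s1 | exact: sM].
Qed.

HB.instance Definition _ :=
  GRing.isZmodMorphism.Build (coefring F) F special special_zmod.
HB.instance Definition _ :=
  GRing.isMonoidMorphism.Build (coefring F) F special special_monoid.

Lemma special_factor i : (0 < i)%N ->
  special (1 + (<< ucm 0%N >> : coefring F) * << ucm i >>) = (i != k)%:R.
Proof.
have e j : special << ucm j >> = v j.
  by rewrite /special monalg.mmapU mul1r /h monalg.mdomU big_seq_fset1 monalg.cmUU.
move=> i_gt0.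
rewrite rmorphD.
rewrite rmorph1.
rewrite rmorphM /=.
etransitivity; first exact: (congr2 (fun x y => 1 + x * y) (e 0%N) (e i)).
rewrite /v eqxx mul1r.
by rewrite gtn_eqF //; case: eqP; rewrite ?subrr ?addr0.
Qed.

End Specialization.

Lemma beta_avarE (F : fieldType) i :
  1 + betavar * avar i =
    FracField.tofrac (1 + (<< ucm 0%N >> : coefring F) * << ucm i >>).
Proof. by rewrite rmorphD rmorph1 rmorphM. Qed.

Lemma beta_avar_neq0 (F : fieldType) i :
  (0 < i)%N -> 1 + betavar * avar i != 0 :> ratfun F.
Proof.
move=> i_gt0; rewrite beta_avarE tofrac_eq0; apply/eqP.
move=> /(congr1 (@special F i.+1)); rewrite special_factor // rmorph0.
by rewrite ltn_eqF //; apply/eqP; rewrite oner_eq0.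
Qed.

Lemma prod_beta_avar_neq (F : fieldType) n (f g : 'I_n -> nat) (i : 'I_n) :
  (forall j, 0 < f j)%N -> (forall j, 0 < g j)%N -> (forall j, f j != g i) ->
  \prod_(j < n) (1 + betavar * avar (f j)) != \prod_(j < n) (1 + betavar * avar (g j))
    :> ratfun F.
Proof.
move=> f_gt0 g_gt0 neq.
pose G (e : 'I_n -> nat) : coefring F :=
  \prod_j (1 + (<< ucm 0%N >> : coefring F) * << ucm (e j) >>).
have fracE e : \prod_j (1 + betavar * avar (e j)) = FracField.tofrac (G e).
  by rewrite rmorph_prod; apply: eq_bigr => j _; apply: beta_avarE.
have specE k e : (0 < k)%N -> (forall j, 0 < e j)%N ->
    special k (G e) = \prod_j (e j != k)%:R.
  by move=> k_gt0 e_gt0; rewrite rmorph_prod; apply: eq_bigr => j _;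
     apply: special_factor.
apply/eqP => fg; have /eqP := etrans (esym (fracE f)) (etrans fg (fracE g)).
rewrite tofrac_eq => /eqP /(congr1 (special (g i))) Gfg.
have := etrans (esym (specE _ f (g_gt0 i) f_gt0))
  (etrans Gfg (specE _ g (g_gt0 i) g_gt0)).
move: {fracE specE fg Gfg G} (oner_neq0 F) => /eqP F1 pfg; apply: F1.
rewrite big1 in pfg => [|j _]; last by rewrite neq.
by rewrite pfg (bigD1 i) //= eqxx mul0r.
Qed.

Definition oplus (R : comNzRingType) (b x y : R) : R := x + y + b * x * y.
Definition ominus (K : fieldType) (b x : K) : K := - x / (1 + b * x).

Lemma one_beta_ominus (K : fieldType) (b x : K) :
  1 + b * x != 0 -> 1 + b * ominus b x = (1 + b * x)^-1.
Proof.
move=> nz; apply: (mulIf nz); rewrite mulVf // mulrDl mul1r -mulrA /ominus.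
by rewrite -[_ / _ * _]mulrA mulVf // mulr1 mulrN addrK.
Qed.

(** Partitions with at most n parts, padded with zeros; rows and columns are
    numbered from 0, so that the box in row i and column j is (i.-1, j.-1). *)

Record part (n : nat) := Part {
  part_tuple :> n.-tuple nat;
  part_sorted : sorted geq part_tuple
}.

HB.instance Definition _ n := [isSub for @part_tuple n].
HB.instance Definition _ n := [Countable of part n by <:].

Section Partitions.

Variable n : nat.

Implicit Types (la mu nu rho eta : part n) (R : seq (part n)).

Definition part_at la (i : 'I_n) : nat := tnth la i.
Coercion part_at : part >-> Funclass.

Definition diagram la : seq ('I_n * nat) :=
  [seq (i, j) | i <- enum 'I_n, j <- iota 0 (la i)].

Definition part_sub la mu : bool := all (fun b => b \in diagram mu) (diagram la).

Definition skew mu la : seq ('I_n * nat) :=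
  [seq b <- diagram mu | b \notin diagram la].

Definition rook la mu : bool :=
  [&& part_sub la mu, uniq [seq b.1 | b <- skew mu la]
    & uniq [seq b.2 | b <- skew mu la]].

Definition rooks la mu : bool := rook la mu && (la != mu).

Lemma mem_diagram la i j : ((i, j) \in diagram la) = (j < la i)%N.
Proof.
apply/allpairsPdep/idP => [[i' [j' [_ + [-> ->]]]]|lt_j].
  by rewrite mem_iota.
by exists i, j; rewrite mem_enum mem_iota.
Qed.

Lemma diagram_uniq la : uniq (diagram la).
Proof.
apply: allpairs_uniq_dep => [||[i j] [i' j'] _ _ [-> ->] //].
  exact: enum_uniq.
by move=> i _; apply: iota_uniq.
Qed.

Lemma part_subP la mu : reflect (forall i, la i <= mu i)%N (part_sub la mu).
Proof.
apply: (iffP allP) => [sub i | le [i j]].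
  rewrite leqNgt; apply/negP => lt_i.
  by have := sub (i, mu i); rewrite !mem_diagram lt_i ltnn => /(_ isT).
by rewrite !mem_diagram => lt_j; apply: leq_trans (le i).
Qed.

(* Finite enumerations of the ranges of the sums below. *)

Definition boxed (m : nat) : seq (part n) :=
  pmap insub [seq map_tuple (@nat_of_ord m.+1) t | t <- enum {: n.-tuple 'I_m.+1}].

Lemma mem_boxed m la : (la \in boxed m) = [forall i, la i <= m]%N.
Proof.
rewrite mem_pmap_sub /=; apply/mapP/forallP => [[t _ e] i | le_m].
  by rewrite /part_at e tnth_map -ltnS.
exists [tuple inord (la i) | i < n]; first by rewrite mem_enum.
apply: eq_from_tnth => i; rewrite tnth_map tnth_mktuple inordK //.
by rewrite ltnS; apply: le_m.
Qed.

Lemma boxed_uniq m : uniq (boxed m).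
Proof.
apply: pmap_sub_uniq; rewrite map_inj_uniq ?enum_uniq // => s t e.
apply: eq_from_tnth => i; apply: val_inj.
by have /(congr1 (fun u => tnth u i)) := e; rewrite !tnth_map.
Qed.

Definition width la : nat := \max_i la i.

Definition rook_above mu : seq (part n) :=
  [seq la <- boxed (width mu).+1 | rooks mu la].

Definition rook_below nu : seq (part n) :=
  [seq eta <- boxed (width nu) | rooks eta nu].

Lemma mem_rook_above mu la : (la \in rook_above mu) = rooks mu la.
Proof.
rewrite mem_filter andb_idr // mem_boxed => /andP [/and3P [sub uniq_row _] _].
apply/forallP => i; apply: leq_trans (_ : (mu i).+1 <= _)%N; last first.
  by rewrite ltnS; apply: (leq_bigmax i).
rewrite leqNgt; apply/negP => lt_i.
have sk j : (mu i <= j < la i)%N -> (i, j) \in skew la mu.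
  by rewrite mem_filter !mem_diagram -leqNgt.
have s0 : (i, mu i) \in skew la mu by apply: sk; rewrite leqnn ltnW.
have s1 : (i, (mu i).+1) \in skew la mu by apply: sk; rewrite leqnSn.
have e0 := nth_index (i, mu i) s0; have e1 := nth_index (i, mu i) s1.
have := uniqP i uniq_row (index (i, mu i) (skew la mu))
  (index (i, (mu i).+1) (skew la mu)).
rewrite !inE size_map !index_mem s0 s1 => /(_ isT isT).
rewrite !(nth_map (i, mu i)) ?index_mem // e0 e1 => /(_ erefl) e.
by move: e1; rewrite -e e0 => [[/eqP]]; rewrite eqn_leq ltnn andbF.
Qed.

Lemma mem_rook_below nu eta : (eta \in rook_below nu) = rooks eta nu.
Proof.
rewrite mem_filter andb_idr // mem_boxed => /andP [/and3P [/part_subP sub _ _] _].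
by apply/forallP => i; apply: leq_trans (sub i) _; apply: (leq_bigmax i).
Qed.

Lemma rook_above_uniq mu : uniq (rook_above mu).
Proof. exact/filter_uniq/boxed_uniq. Qed.

Lemma rook_below_uniq nu : uniq (rook_below nu).
Proof. exact/filter_uniq/boxed_uniq. Qed.

(* A chain mu = rho_0, rho_1, ..., rho_l = nu is encoded by the sequence
   [:: rho_1; ...; rho_l]. *)
Fixpoint chains_of_length (l : nat) mu nu : seq (seq (part n)) :=
  if l is l'.+1 then
    [seq la :: R | la <- rook_above mu, R <- chains_of_length l' la nu]
  else if mu == nu then [:: [::]] else [::].

Definition chains mu nu : seq (seq (part n)) :=
  flatten [seq chains_of_length l mu nu | l <- iota 0 (size (diagram nu)).+1].

Lemma mem_chains_of_length l mu nu R :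
  (R \in chains_of_length l mu nu) =
  [&& size R == l, path rooks mu R & last mu R == nu].
Proof.
elim: l mu R => [|l IHl] mu R /=.
  by case: R => [|la R]; case: (mu == nu) => //=; rewrite inE.
apply/allpairsPdep/idP => [[la [R' [la_mu R'_la ->]]] | ].
  by rewrite /= eqSS -mem_rook_above la_mu; rewrite IHl in R'_la.
case: R => [//|la R] /=; rewrite eqSS => /and3P [sR /andP [mu_la pR] lR].
by exists la, R; rewrite mem_rook_above IHl sR mu_la pR lR.
Qed.

Lemma rooks_size la mu :
  rooks la mu -> (size (diagram la) < size (diagram mu))%N.
Proof.
case/andP => /and3P [/part_subP sub _ _] neq.
have sz rho : size (diagram rho) = (\sum_i rho i)%N.
  rewrite size_allpairs_dep sumnE big_map big_enum /=.
  by apply: eq_bigr => i _; rewrite size_iota.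
rewrite !sz ltnNge; apply: contra neq => le; apply/eqP/val_inj.
apply: eq_from_tnth => i; apply/eqP.
have /leqif_sum [_] : forall i, true -> (la i <= mu i ?= iff (la i == mu i))%N.
  by move=> j _; split=> //; apply: sub.
rewrite eqn_leq le andbT leq_sum => [/esym/forallP /(_ i) // | j _].
exact: sub.
Qed.

Lemma mem_chains mu nu R :
  (R \in chains mu nu) = path rooks mu R && (last mu R == nu).
Proof.
apply/flatten_mapP/idP => [[l _] | ].
  by rewrite mem_chains_of_length => /andP [].
case/andP => pR lR; exists (size R); last first.
  by rewrite mem_chains_of_length eqxx pR.
rewrite mem_iota /= add0n ltnS -(eqP lR) {lR}.
apply: leq_trans (_ : size R + size (diagram mu) <= _)%N; first exact: leq_addr.
elim: R mu pR => [|la R IHR] mu //= /andP [/rooks_size lt_mu /IHR le].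
by apply: leq_trans le; rewrite addSnnS leq_add2l.
Qed.

Lemma chains_uniq mu nu : uniq (chains mu nu).
Proof.
have uniq_l l la : uniq (chains_of_length l la nu).
  elim: l la => [|l IHl] la /=; first by case: (la == nu).
  apply: allpairs_uniq_dep => [|rho _|[x R] [y R'] _ _ [-> ->] //].
    exact: rook_above_uniq.
  exact: IHl.
rewrite /chains; elim: (iota _ _) (iota_uniq 0 (size (diagram nu)).+1) => //= l s IHs.
case/andP => lNs /IHs uniq_s; rewrite cat_uniq uniq_l uniq_s andbT /=.
apply/hasPn => R /flatten_mapP [k ks]; rewrite /= !mem_chains_of_length.
case/and3P => /eqP -> _ _; apply/negP => /and3P [/eqP e _ _].
by rewrite -e ks in lNs.
Qed.

End Partitions.

Section Grothendieck.

Variables (K : fieldType) (n : nat) (beta : K) (a : nat -> K).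

Implicit Types (la mu nu : part n) (P : {mpoly K[n]}).

Definition box la : finType := seq_sub (diagram la).
Definition box_row la (b : box la) : 'I_n := (ssval b).1.
Definition box_col la (b : box la) : nat := (ssval b).2.

Definition left_of la (b b' : box la) : bool :=
  (box_row b' == box_row b) && (box_col b' == (box_col b).+1).
Definition above la (b b' : box la) : bool :=
  (val (box_row b') == (box_row b).+1) && (box_col b' == box_col b).

(* The entry r : 'I_n stands for the number r.+1 in {1, ..., n}.  The sets
   T b being non-empty, max (T b) <= min (T b') means that r <= s for all r
   in T b and s in T b'. *)
Definition set_valued_tableau la (T : {ffun box la -> {set 'I_n}}) : bool :=
  [&& [forall b, T b != set0],
      [forall b, forall b', left_of b b' ==>
         [forall r in T b, forall s in T b', (r <= s)%N]]
    & [forall b, forall b', above b b' ==>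
         [forall r in T b, forall s in T b', (r < s)%N]]].

Definition tableau_size la (T : {ffun box la -> {set 'I_n}}) : nat :=
  (\sum_b #|T b|)%N.

(* Columns strictly increase, so an entry r.+1 of a box of (0-based) row i
   satisfies i <= r: the truncated subtraction below is exact and the index
   r.+1 + c(b) is at least 1. *)
Definition grothendieck la : {mpoly K[n]} :=
  \sum_(T : {ffun box la -> {set 'I_n}} | set_valued_tableau T)
    (beta ^+ (tableau_size T - size (diagram la)))%:MP_[n] *
    \prod_b \prod_(r in T b)
      oplus beta%:MP_[n] 'X_r (a (r.+1 + box_col b - box_row b)%N)%:MP_[n].

(* For a row i counted from 0, n + 1 - (i + 1) = n - i. *)
Definition apoint la (i : 'I_n) : K :=
  ominus beta (a (n - i + la i)%N).

Definition Pi (y : 'I_n -> K) : K := \prod_i (1 + beta * y i).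

Definition skew_size mu la : nat := size (skew mu la).

Definition expansion_coefs P (g : part n -> part n -> K) : Prop :=
  forall mu, exists s : seq (part n),
    [/\ uniq s, forall nu, nu \notin s -> g mu nu = 0
      & P * grothendieck mu = \sum_(nu <- s) g mu nu *: grothendieck nu].

Definition recurrence (g : part n -> part n -> K) : Prop :=
  forall mu nu, mu != nu ->
    g mu nu =
      (Pi (apoint nu) - Pi (apoint mu))^-1 *
      (\sum_(la <- rook_above mu)
          Pi (apoint mu) * beta ^+ skew_size la mu * g la nu
       - \sum_(eta <- rook_below nu)
          Pi (apoint eta) * beta ^+ skew_size nu eta * g mu eta).

Definition boundary P (g : part n -> part n -> K) : Prop :=
  (forall mu nu, ~~ part_sub mu nu -> g mu nu = 0) /\
  (forall la, g la la = P.@[apoint la]).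

Definition chain_formula P mu nu : K :=
  beta ^+ skew_size nu mu *
  \sum_(R <- chains mu nu)
    let l := size R in
    let rho k := nth mu (mu :: R) k in
    (\prod_(0 <= i < l) Pi (apoint (rho i))) *
    \sum_(0 <= k < l.+1)
      P.@[apoint (rho k)] *
      \prod_(0 <= i < l.+1 | i != k)
        (Pi (apoint (rho k)) - Pi (apoint (rho i)))^-1.

End Grothendieck.

Lemma part_geq n (la : part n) (i j : 'I_n) : (i <= j)%N -> (la j <= la i)%N.
Proof.
have geq_trans : transitive geq by move=> x y z /[swap]; apply: leq_trans.
move=> le_ij; rewrite /part_at !(tnth_nth 0%N).
by apply: (sorted_leq_nth geq_trans leqnn 0%N (part_sorted la));
  rewrite ?inE ?size_tuple.
Qed.

Lemma part_index_gt0 n (la : part n) (i : 'I_n) : (0 < n - i + la i)%N.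
Proof. by rewrite addn_gt0 subn_gt0 ltn_ord. Qed.

Lemma ex_part_index_neq n (la mu : part n) : la != mu ->
  (exists i : 'I_n, forall j : 'I_n, n - j + la j != n - i + mu i)%N \/
  (exists i : 'I_n, forall j : 'I_n, n - j + mu j != n - i + la i)%N.
Proof.
move=> neq; have /existsP [i0 neq0] : [exists i, la i != mu i].
  apply: contraR neq; rewrite negb_exists => /forallP eq_i.
  by apply/eqP/val_inj/eq_from_tnth => i; apply/eqP; have := eq_i i; rewrite negbK.
have [i neq_i min_i] := @arg_minnP _ i0 (fun i => la i != mu i) val neq0.
have eq_j (j : 'I_n) : (j < i)%N -> la j = mu j.
  by move=> lt_ji; apply/eqP; apply: contraTT lt_ji => /min_i; rewrite -leqNgt.
have gen (r s : part n) : (r i < s i)%N ->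
    (forall j : 'I_n, (j < i)%N -> r j = s j) ->
    forall j : 'I_n, (n - j + r j != n - i + s i)%N.
  move=> lt_i eq_rs j; have [le_ij | lt_ji] := leqP i j.
    rewrite ltn_eqF //; apply: leq_ltn_trans (_ : n - i + r i < _)%N.
      by apply: leq_add; rewrite ?leq_sub2l ?part_geq.
    by rewrite ltn_add2l.
  rewrite gtn_eqF // eq_rs //; apply: leq_ltn_trans (_ : n - i + s j < _)%N.
    by rewrite leq_add2l part_geq // ltnW.
  by rewrite ltn_add2r ltn_sub2l.
case: (ltngtP (la i) (mu i)) neq_i => // lt _; [left | right]; exists i.
  exact: gen lt eq_j.
by apply: gen lt _ => j /eq_j.
Qed.

Lemma Pi_apointE (K : fieldType) n (b : K) a (la : part n) :
  (forall k, (0 < k)%N -> 1 + b * a k != 0) ->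
  Pi b (apoint b a la) = (\prod_(i < n) (1 + b * a (n - i + la i)%N))^-1.
Proof.
move=> nz; rewrite -prodfV; apply: eq_bigr => i _; apply: one_beta_ominus.
exact/nz/part_index_gt0.
Qed.

(* The denominators in the recurrence and in its solution do not vanish. *)
Lemma Pi_apoint_neq (F : fieldType) n (la mu : part n) : la != mu ->
  Pi betavar (apoint betavar avar la) != Pi betavar (apoint betavar avar mu)
    :> ratfun F.
Proof.
move=> neq; apply/eqP => e; have nz := @beta_avar_neq0 F.
have {}e := etrans (esym (Pi_apointE la nz)) (etrans e (Pi_apointE mu nz)).
move/invr_inj: e; apply/eqP; case: (ex_part_index_neq neq) => [] [i ne].
  by apply: (@prod_beta_avar_neq F n (fun j : 'I_n => n - j + la j)%N
    (fun j : 'I_n => n - j + mu j)%N i) => // j; apply: part_index_gt0.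
rewrite eq_sym; apply: (@prod_beta_avar_neq F n (fun j : 'I_n => n - j + mu j)%N
  (fun j : 'I_n => n - j + la j)%N i) => // j; exact: part_index_gt0.
Qed.

(* Main.v *)
(* The Pieri-type rule
     Pi(x) G_mu(x|a) = Pi(a_mu) sum_(mu => la) beta^|la/mu| G_la(x|a)
   turns P Pi G_mu, expanded in two ways, into the recurrence, as soon as the
   G_la are independent.  Independence and the boundary conditions come from
   triangularity: G_la(a_ka) = 0 unless la is contained in ka, and
   G_ka(a_ka) <> 0.  Both facts follow by induction on the number of variables
   from the branching rule obtained by removing the largest letter from a
   set-valued tableau: in the Pieri rule the branching step commutes with adding
   a rook strip, which is a telescoping identity between products over the rows.
   The recurrence has a unique solution by induction on |nu/mu|, and the sum over
   chains is a solution by the recursion for divided differences. *)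
Require Import Defs.
From mathcomp Require Import all_boot all_order all_algebra.
From mathcomp Require Import perm mpoly ring zify.

Set Implicit Arguments.
Unset Strict Implicit.
Unset Printing Implicit Defensive.

Import GRing.Theory.
Local Open Scope ring_scope.

(** * The branching recursion *)

(** Weighting [G_la] by [beta ^ |la|] replaces [x (+) a_j] by [v * b j - 1], so [Pi(x)] is a product
    of factors [v], [Pi(a_la)] is the inverse of the product of [b] over the positions of la, and a
    factor vanishes exactly when [v * b j = 1]. With positions in place of parts, the index r + c of
    a box of the last letter is itself a position, and interlacing of shapes becomes a pair of
    inequalities. In the commutation step the large shape l and a shape w in one variable less are
    held fixed, and the shape between them is summed over in two ways: remove the letter and then
    add the strip, or the reverse. Both sums factor over rows, but a row of one product reads two
    consecutive rows of w where the other reads them shifted, so only the full products agree, and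
    degenerate w need separate care. The Pieri rule is not proved as a polynomial identity: it is
    used only at the dual points, where [Pi(x)] is a scalar. By triangularity, these values already
    determine every finite combination of the [G_la]. *)

Definition ext M k (m : {ffun 'I_k -> 'I_M}) (i : nat) : nat :=
  if insub i is Some j then val (m j) else 0%N.

Lemma ext_ord M k (m : {ffun 'I_k -> 'I_M}) (i : 'I_k) : ext m i = m i.
Proof. by rewrite /ext valK. Qed.

Lemma extE M k (m : {ffun 'I_k -> 'I_M}) (j : 'I_k) (i : nat) :
  i = j -> ext m i = m j.
Proof. by move->; rewrite ext_ord. Qed.

(** The value 0 at index k acts as the position of the missing row below the last one; this is what
    [Vk] asks for below. *)
Lemma ext_out M k (m : {ffun 'I_k -> 'I_M}) i : (k <= i)%N -> ext m i = 0%N.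
Proof. by move=> le_ki; rewrite /ext insubN // -leqNgt. Qed.

Lemma prod_natr_bool (R : comPzSemiRingType) (I : finType) (c : pred I) :
  \prod_i (c i)%:R = [forall i, c i]%:R :> R.
Proof.
have [/forallP c_all | ] := boolP [forall i, c i].
  by rewrite big1 // => i _; rewrite c_all.
by case/forallPn => i /negbTE ci; rewrite (bigD1 i) //= ci mul0r.
Qed.

Section Transfer.

Variables (K : fieldType) (b u : nat -> K) (M : nat).

(* A partition la with at most k parts is encoded by its positions
   l i = la_i + k - i, for i < k.  With b j = 1 + beta a_j and v = 1 + beta x,
   the factor v * b j - 1 is beta (x (+) a_j).  [link v p q r] is the weight of
   the boxes of row i containing the last letter when l i = p, l i.+1 = r, and
   the row has position q once this letter is removed: [strip] collects the
   boxes containing only that letter, and the factor v * b q the choice of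
   whether the last remaining box of the row also contains it. *)
Definition strip (v : K) p q : K := \prod_(p.+1 <= j < q) (v * b j - 1).

Definition link (v : K) p q r : K :=
  if (r <= q < p)%N then strip v q p * (if (r < q)%N then v * b q else 1) else 0.

(* This is beta ^ |la| G_la(x_1, ..., x_k | a). *)
Fixpoint branch_sum k (l : nat -> nat) : K :=
  if k is k'.+1 then
    \sum_(m : {ffun 'I_k' -> 'I_M})
      (\prod_(i < k') link (u k') (l i) (m i) (l i.+1)) * strip (u k') 0 (l k')
      * branch_sum k' (ext m)
  else 1.

Lemma eq_branch_sum k l l' : (forall i, (i < k)%N -> l i = l' i) ->
  branch_sum k l = branch_sum k l'.
Proof.
case: k => [//|k] e /=; apply: eq_bigr => m _; rewrite e //; congr (_ * _ * _).
by apply: eq_bigr => i _; rewrite !e // ltnS // ltnW.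
Qed.

Definition strict k (l : nat -> nat) : Prop :=
  (forall i, (i < k)%N -> (0 < l i)%N) /\
  (forall i, (i.+1 < k)%N -> (l i.+1 < l i)%N).

Lemma sum_step_up p t (F : nat -> K) : (p.+1 < M)%N ->
  \sum_(q < M) ((val q == p) || (val q == p.+1) && t)%:R * F q =
  F p + (if t then F p.+1 else 0).
Proof.
move=> lt_pM; rewrite (bigD1 (Ordinal (ltnW lt_pM))) //= eqxx mul1r.
congr (_ + _); rewrite (bigD1 (Ordinal lt_pM)) /=; last first.
  by rewrite -val_eqE /= gtn_eqF.
rewrite gtn_eqF // eqxx /= big1 ?addr0 => [|q /andP[]].
  by case: t; rewrite ?mul1r ?mul0r.
by rewrite -!val_eqE /= => /negbTE -> /negbTE ->; rewrite mul0r.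
Qed.

Lemma sum_step_down p r (F : nat -> K) : (p < M)%N ->
  \sum_(q < M) ((val q == p) || (q.+1 == p) && (r < q)%N)%:R * F q =
  F p + (if (0 < p)%N && (r < p.-1)%N then F p.-1 else 0).
Proof.
move=> lt_pM; rewrite (bigD1 (Ordinal lt_pM)) //= eqxx mul1r.
congr (_ + _); case: p lt_pM => [|p] lt_pM /=.
  by rewrite big1 // => q; rewrite -val_eqE /= => /negbTE ->; rewrite mul0r.
rewrite (bigD1 (Ordinal (ltnW lt_pM))) /=; last first.
  by rewrite -val_eqE /= ltn_eqF.
rewrite ltn_eqF // eqxx /= big1 ?addr0 => [|q /andP[]].
  by case: ifP; rewrite ?mul1r ?mul0r.
by rewrite -!val_eqE /= eqSS => /negbTE -> /negbTE ->; rewrite mul0r.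
Qed.

Lemma strip_geq v p q : (q <= p.+1)%N -> strip v p q = 1.
Proof. by move=> le_qp; rewrite /strip big_geq. Qed.

Lemma stripSr v p q : (p < q)%N -> strip v p q.+1 = strip v p q * (v * b q - 1).
Proof. by move=> lt_pq; rewrite /strip big_nat_recr. Qed.

Lemma stripSl v p q : (p.+1 < q)%N -> strip v p q = (v * b p.+1 - 1) * strip v p.+1 q.
Proof. by move=> lt_pq; rewrite /strip big_ltn. Qed.

(* For fixed l and V, both sums over an intermediate partition in the proof of
   [pieri] are products over the rows, of [Usum] and [Ssum] respectively. *)
Definition colfac (v : K) p q : K := if (q < p)%N then strip v q p else 0.
Definition diagfac (v : K) q r : K :=
  if (r < q)%N then v * b q else (r == q)%:R.

(** Separates p from r. In a sum over the positions of the outer shape, each position then meets one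
    [colfac] (own row) and one [diagfac] (row above), so the sum factors over rows. *)
Lemma linkE v p q r : link v p q r = colfac v p q * diagfac v q r.
Proof.
rewrite /link /colfac /diagfac; case: (ltngtP r q) => _ /=; case: ifP;
by rewrite ?mulr0 ?mul0r.
Qed.

Hypothesis b_neq0 : forall j, (0 < j)%N -> b j != 0.

(** * Commuting a branching step with the addition of a rook strip *)

Section Local.

Variable v : K.

Definition Usum p V r V' : K :=
  \sum_(q < M) ((val q == V) || (q.+1 == V) && (V' < q)%N)%:R
    * (link v p q r / b q).

Definition Ssum t r V' (D : nat -> K) : K :=
  \sum_(q < M) ((val q == r) || (val q == r.+1) && t)%:R
    * (colfac v q V' * D q).

(* [Usum] and [Ssum] agree row by row only up to a coboundary, this factor. *)
Definition cfac p V : K := if p == V then v * b p else 1.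

Lemma SsumE t r V' D : (r.+1 < M)%N ->
  Ssum t r V' D = colfac v r V' * D r + (if t then colfac v r.+1 V' * D r.+1 else 0).
Proof. exact: (@sum_step_up r t (fun q => colfac v q V' * D q)). Qed.

Lemma UsumE p V r V' : (V < M)%N ->
  Usum p V r V' = link v p V r / b V +
    (if (0 < V)%N && (V' < V.-1)%N then link v p V.-1 r / b V.-1 else 0).
Proof. exact: (@sum_step_down V V' (fun q => link v p q r / b q)). Qed.

(** Row 0 can always receive a box and has no row above it, whence [D = 1]; the factor v of the
    whole exchange identity comes from this row. *)
Lemma Ssum_first r V' : (r.+1 < M)%N -> (V' <= r)%N ->
  Ssum true r V' (fun=> 1) * cfac r V' = v * b r * strip v V' r.
Proof.
move=> rM le_V'r; rewrite SsumE // /colfac /cfac ltnS le_V'r !mulr1.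
move: le_V'r; rewrite leq_eqVlt => /orP [/eqP -> | lt].
  by rewrite eqxx ltnn !strip_geq //; ring.
by rewrite lt gtn_eqF // stripSr //; ring.
Qed.

(** The two sides are compared through a common factor t instead of a quotient, because
    [strip v V p] may be 0. *)
Lemma local_exchange p V r V' : (V < M)%N -> (r.+1 < M)%N ->
  (0 < r < p)%N -> (V' < V)%N -> (V' <= r <= V)%N -> (V <= p)%N ->
  exists t : K, Usum p V r V' = strip v V p * t /\
    Ssum (r.+1 < p)%N r V' (diagfac v V) * cfac r V' =
      b r * cfac p V * t * strip v V' r.
Proof.
move=> VM rM /andP [r_gt0 lt_rp] lt_V'V /andP [le_V'r le_rV] le_Vp.
have V_gt0 : (0 < V)%N by apply: leq_trans le_rV.
have nzr := b_neq0 r_gt0; have nzV := b_neq0 V_gt0.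
(* [t1] and [t2] are the contributions of the inner positions V and [V.-1] to [Usum], freed of
   [strip v V p]. *)
pose t1 := if (V < p)%N then (if (r < V)%N then v else (b V)^-1) else 0.
pose t2 := if (V' < V.-1)%N && (r <= V.-1)%N then
  (if (V < p)%N then v * b V - 1 else 1) *
  (if (r < V.-1)%N then v else (b V.-1)^-1) else 0.
have V1_gt0 : (r <= V.-1)%N -> (0 < V.-1)%N by apply: leq_trans.
exists (t1 + t2); split.
  rewrite UsumE // V_gt0 mulrDr /link le_rV /=; congr (_ + _).
    rewrite /t1; case: ifP => _; last by rewrite mul0r mulr0.
    by rewrite -mulrA; congr (_ * _); case: ifP; rewrite ?mul1r ?mulfK.
  rewrite /t2; case: (V' < V.-1)%N => /=; last by rewrite mulr0.
  have -> : (V.-1 < p)%N by lia.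
  rewrite andbT; case: ifP => [le_rV1 | _]; last by rewrite mul0r mulr0.
  have nzV1 := b_neq0 (V1_gt0 le_rV1).
  have -> : strip v V.-1 p = strip v V p * (if (V < p)%N then v * b V - 1 else 1).
    case: ltnP => [lt_Vp | le_pV]; last by rewrite !strip_geq ?mulr1 //; lia.
    by rewrite [in LHS]stripSl ?prednK // mulrC.
  by rewrite -!mulrA; do 2!congr (_ * _); case: ifP; rewrite ?mul1r ?mulfK.
rewrite SsumE // /colfac /cfac /diagfac ltnS le_V'r.
(* The form of [diagfac v V] at r and [r.+1] depends on whether V is r, [r.+1] or larger. *)
have [d0 | [d1 | d2]] : (V = r \/ V = r.+1 \/ r.+1 < V)%N by lia.
- subst V; rewrite /t1 /t2 ltnn eqxx lt_rp lt_V'V (gtn_eqF lt_V'V) (gtn_eqF lt_rp).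
  have -> : (r <= r.-1)%N = false by lia.
  have -> : (r.+1 < r)%N = false by lia.
  by rewrite andbF (gtn_eqF (ltnSn r)); case: ifP => _ /=; field.
- subst V; rewrite /t1 /t2 /= !ltnn (leqnn r) (leqnn r.+1) eqxx andbT.
  have [e|lt_V'r] := eqVneq r V'; first subst V'.
    rewrite ltnn !strip_geq //; have := le_Vp; rewrite leq_eqVlt => /orP [/eqP <- | lt].
      by rewrite ltnn eqxx /=; ring.
    by rewrite lt gtn_eqF //=; ring.
  have {}lt_V'r : (V' < r)%N by rewrite ltn_neqAle eq_sym lt_V'r.
  rewrite lt_V'r stripSr //.
  have := le_Vp; rewrite leq_eqVlt => /orP [/eqP <- | lt].
    by rewrite ltnn eqxx /=; field.
  by rewrite lt gtn_eqF //=; field.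
rewrite /t1 /t2 d2 (ltnW d2).
have -> : (V' < V.-1)%N by lia.
have -> : (r <= V.-1)%N by lia.
have -> : (r < V.-1)%N by lia.
have -> : (r.+1 < p)%N by lia.
have [e|lt_V'r] := eqVneq r V'; first subst V'.
  rewrite ltnn !strip_geq //; have := le_Vp; rewrite leq_eqVlt => /orP [/eqP <- | lt].
    by rewrite ltnn eqxx /=; ring.
  by rewrite lt gtn_eqF //=; ring.
have {}lt_V'r : (V' < r)%N by rewrite ltn_neqAle eq_sym lt_V'r.
rewrite lt_V'r stripSr //.
have := le_Vp; rewrite leq_eqVlt => /orP [/eqP <- | lt].
  by rewrite ltnn eqxx /=; ring.
by rewrite lt gtn_eqF //=; ring.
Qed.

Section Row.

Variables (k : nat) (l V : nat -> nat).

Definition addable i := (i == 0%N) || ((l i).+1 < l i.-1)%N.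

Definition prevfac i : nat -> K := if i is i'.+1 then diagfac v (V i') else fun=> 1.

Definition Sterm i := Ssum (addable i) (l i) (V i) (prevfac i).
Definition Uterm i := Usum (l i) (V i) (l i.+1) (V i.+1).

Hypothesis l_strict : strict k.+1 l.
Hypothesis l_lt : forall i, (i <= k)%N -> ((l i).+1 < M)%N.
Hypothesis V_lt : forall i, (i < k)%N -> (V i < M)%N.
Hypothesis Vk : V k = 0%N.

(** [local_exchange] trades the [cfac] of row j.+1 for that of row j, so partial products agree up
    to the [cfac] of their last row. At row k it equals 1, since V k = 0 < l k. *)
Lemma telescope :
  (forall i, (i < k)%N -> (V i.+1 < V i)%N) ->
  (forall i, (i < k)%N -> (l i.+1 <= V i <= l i)%N) ->
  \prod_(i < k.+1) Sterm i =
  v * (\prod_(i < k.+1) b (l i)) * (\prod_(i < k) Uterm i) * strip v 0 (l k).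
Proof.
case: l_strict => l_gt0 l_decr V_decr V_l.
have Vl i : (i <= k)%N -> (V i <= l i)%N.
  by rewrite leq_eqVlt => /orP [/eqP -> | /V_l /andP []]; rewrite ?Vk.
suff: \prod_(i < k.+1) Sterm i * cfac (l k) (V k) =
  v * (\prod_(i < k.+1) b (l i)) * (\prod_(i < k) Uterm i) * strip v (V k) (l k).
  by rewrite {1}/cfac Vk gtn_eqF ?mulr1 // l_gt0.
elim: {-2}k (leqnn k) => [|j IHj] le_jk.
  rewrite !big_ord1 big_ord0 mulr1; apply: Ssum_first; last exact: Vl.
  exact: l_lt.
have {}IHj := IHj (ltnW le_jk); have /andP [Vj1 Vj2] := V_l j le_jk.
have pos : (0 < l j.+1 < l j)%N by rewrite l_gt0 // l_decr.
have mid : (V j.+1 <= l j.+1 <= V j)%N by rewrite Vl.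
have [t [Ut St]] :=
  local_exchange (V_lt le_jk) (l_lt le_jk) pos (V_decr j le_jk) mid Vj2.
rewrite big_ord_recr /= -mulrA [Sterm _ * _]St.
rewrite [\prod_(i < j.+2) b _]big_ord_recr [\prod_(i < j.+1) Uterm _]big_ord_recr /=.
rewrite [Uterm j]Ut.
transitivity (\prod_(i < j.+1) Sterm i * cfac (l j) (V j) * b (l j.+1) * t *
  strip v (V j.+1) (l j.+1)); first by ring.
by rewrite IHj; ring.
Qed.

Lemma Usum_eq0 i : (i < k)%N -> ~~ (l i.+1 <= V i <= l i)%N -> Uterm i = 0.
Proof.
case: l_strict => l_gt0 l_decr lt_ik nle; rewrite /Uterm UsumE ?V_lt // /link.
have gt0 : (0 < l i.+1)%N by apply: l_gt0.
have -> : (l i.+1 <= V i < l i)%N = false by lia.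
case: ifP => [/andP [V_gt0 lt]|]; last by rewrite mul0r addr0.
have -> : (l i.+1 <= (V i).-1 < l i)%N = false by lia.
by rewrite !mul0r addr0.
Qed.

Lemma Sterm_eq0 i : (i < k)%N -> ~~ (l i.+1 <= V i <= l i)%N ->
  \prod_(i < k.+1) Sterm i = 0.
Proof.
move=> lt_ik; rewrite negb_and -!ltnNge => /orP [lt | lt].
  rewrite (bigD1 (Ordinal (lt_ik : (i.+1 < k.+1)%N))) //= /Sterm SsumE ?l_lt //=.
  have e1 : (l i.+1 < V i)%N = false by lia.
  have e2 : ((l i.+1).+1 < V i)%N = false by lia.
  rewrite /diagfac e1 e2 /= !gtn_eqF //; last exact: leqW.
  by rewrite !mulr0 if_same addr0 mul0r.
have lt' : (i < k.+1)%N by apply: ltnW.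
rewrite (bigD1 (Ordinal lt')) //= /Sterm SsumE; last exact: (l_lt (ltnW lt_ik)).
have e1 : (V i < l i)%N = false by lia.
have e2 : (V i < (l i).+1)%N = false by lia.
by rewrite /colfac /= e1 e2 !mul0r if_same addr0 mul0r.
Qed.

(** Within the allowed ranges, V i = V i.+1 = l i.+1. Then leaving row i.+1 unchanged is killed by
    [colfac], and lengthening it is killed by [diagfac]. *)
Lemma Sterm_eq0_decr i : (i.+1 < k)%N -> (V i <= V i.+1)%N ->
  \prod_(i < k.+1) Sterm i = 0.
Proof.
move=> lt_ik le; case: (boolP (l i.+1 <= V i <= l i)%N) => [|n]; last first.
  by apply: (@Sterm_eq0 i) => //; apply: ltnW.
case: (boolP (l i.+2 <= V i.+1 <= l i.+1)%N) => [|n]; last first.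
  by move=> _; apply: (@Sterm_eq0 i.+1).
move=> /andP [_ le1] /andP [le2 _].
have e1 : V i = l i.+1 by lia.
have e2 : V i.+1 = l i.+1 by lia.
have lt : (i.+1 < k.+1)%N by lia.
rewrite (bigD1 (Ordinal lt)) //= /Sterm SsumE; last exact: (l_lt (ltnW lt_ik)).
have e3 : ((l i.+1).+1 < l i.+1)%N = false by lia.
rewrite /= e2 /colfac ltnn /= mul0r add0r /diagfac e1 e3 gtn_eqF //.
by rewrite mulr0 if_same mul0r.
Qed.

(** Off the interlacing range both sides vanish. Strictness of V is tested explicitly on the right
    because [Usum] does not exclude V i = V i.+1, whereas the product of the [Sterm] does. *)
Lemma row_exchange :
  \prod_(i < k.+1) Sterm i =
  if [forall i : 'I_k, (V i.+1 < V i)%N] then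
    v * (\prod_(i < k.+1) b (l i)) * (\prod_(i < k) Uterm i) * strip v 0 (l k)
  else 0.
Proof.
have [/existsP [i nle] | ] := boolP [exists i : 'I_k, ~~ (l i.+1 <= V i <= l i)%N].
  rewrite (Sterm_eq0 _ nle) // (bigD1 i) //= (Usum_eq0 _ nle) //.
  by rewrite mul0r mulr0 mul0r if_same.
rewrite negb_exists => /forallP le; case: ifP => [/forallP lt|].
  apply: telescope => i lt_ik; first by have := lt (Ordinal lt_ik).
  by have := le (Ordinal lt_ik); rewrite negbK.
move/negbT; rewrite negb_forall => /existsP [i]; rewrite -leqNgt => le_i.
have [lt_ik | ] := ltnP i.+1 k; first exact: Sterm_eq0_decr le_i.
move=> le_ki; have e : i.+1 = k by apply/eqP; rewrite eqn_leq ltn_ord.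
case: l_strict => l_gt0 _; have := l_gt0 k (ltnSn _).
have := le i; rewrite negbK e => /andP [le1 _].
by rewrite lt0n -leqn0 (leq_trans le1) //; move: le_i; rewrite e Vk.
Qed.

End Row.
End Local.

Definition step (l : nat -> nat) i q : bool :=
  (q == l i) || (q == (l i).+1) && addable l i.

(* [step l] and [step_down V] describe rook strips, in terms of the smaller
   and of the larger partition respectively. *)
Definition step_down (V : nat -> nat) i q : bool :=
  (q == V i) || (q.+1 == V i) && (V i.+1 < q)%N.

Lemma link_neq0 v p q r : link v p q r != 0 -> (r <= q < p)%N.
Proof. by rewrite /link; case: ifP => //; rewrite eqxx. Qed.

Lemma interlace k (l : nat -> nat) (m : {ffun 'I_k -> 'I_M}) v :
  \prod_(i < k) link v (l i) (m i) (l i.+1) != 0 ->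
  (forall i, (i < k)%N -> (l i.+1 <= ext m i < l i)%N).
Proof.
move=> /prodf_neq0 nz i lt_ik; have /link_neq0 := nz (Ordinal lt_ik) isT.
by rewrite -(ext_ord m).
Qed.

Lemma interlace_strict k l m : strict k.+1 l ->
  (forall i, (i < k)%N -> (l i.+1 <= m i < l i)%N) -> strict k m.
Proof.
case=> l_gt0 _ mid; split=> i lt_ik.
  have /andP [le _] := mid i lt_ik; apply: leq_trans le.
  exact: l_gt0.
have /andP [le _] := mid i (ltnW lt_ik); apply: leq_trans le.
by have /andP [] := mid i.+1 lt_ik.
Qed.

(** A box can be added to row i of m when row i.-1 is longer, and removed from row i of v when row
    i.+1 is shorter; in a strip where each row grows by at most one box these tests match. [v k = 0]
    supplies the test for the last row. *)
Lemma steps_down k l (m v : nat -> nat) : strict k.+1 l -> v k = 0%N ->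
  (forall i, (i < k)%N -> (l i.+1 <= m i < l i)%N) ->
  [forall i : 'I_k, step m i (v i)] =
  [forall i : 'I_k, (v i.+1 < v i)%N] && [forall i : 'I_k, step_down v i (m i)].
Proof.
move=> l_str vk mid; have [m_gt0 m_decr] := interlace_strict l_str mid.
apply/forallP/andP => [st | [/forallP decr /forallP st] i].
  have {}st i (lt : (i < k)%N) := st (Ordinal lt).
  have decr i : (i < k)%N -> (v i.+1 < v i)%N.
    move=> lt_ik; have := lt_ik; rewrite leq_eqVlt => /orP [/eqP e | lt1].
      rewrite e vk; have := st i lt_ik; have := m_gt0 i lt_ik.
      by rewrite /step /=; lia.
    have := st i lt_ik; have := st i.+1 lt1; have := m_decr i lt1.
    by rewrite /step /addable /=; lia.
  split; apply/forallP => [[i lt_ik]] /=; first exact: decr.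
  have := st i lt_ik; have := m_gt0 i lt_ik.
  have := lt_ik; rewrite leq_eqVlt => /orP [/eqP e | lt1].
    by rewrite /step_down e vk /step /=; lia.
  have := st i.+1 lt1; have := m_decr i lt1; have := decr i lt_ik.
  by rewrite /step_down /step /addable /=; lia.
have {}st j (lt : (j < k)%N) := st (Ordinal lt).
have {}decr j (lt : (j < k)%N) := decr (Ordinal lt).
case: i => [[|i] lt_ik] /=.
  have := st 0%N lt_ik; have := decr 0%N lt_ik; have := m_gt0 0%N lt_ik.
  by rewrite /step_down /step /addable /=; lia.
have := st _ lt_ik; have := decr _ lt_ik; have := m_gt0 _ lt_ik.
have := st _ (ltnW lt_ik); have := decr _ (ltnW lt_ik).
by rewrite /step_down /step /addable /=; lia.
Qed.

(** Induction on the number of variables, by peeling off the last one. The bound on l leaves room in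
    ['I_M] for an added box. *)
Lemma pieri k l : strict k l -> (forall i, (i < k)%N -> ((l i).+1 < M)%N) ->
  \prod_(r < k) u r * branch_sum k l =
  (\prod_(i < k) b (l i))^-1 *
    \sum_(v : {ffun 'I_k -> 'I_M}) (\prod_(i < k) (step l i (v i))%:R) * branch_sum k (ext v).
Proof.
elim: k l => [|k IHk] l l_str l_lt.
  rewrite !big_ord0 /= invr1 !mul1r.
  under eq_bigr do rewrite big_ord0 mulr1.
  by rewrite sumr_const card_ffun !card_ord expn0.
set v := u k.
have bl_neq0 : \prod_(i < k.+1) b (l i) != 0.
  by apply/prodf_neq0 => i _; apply/b_neq0/(l_str.1 i).
pose dec (w : {ffun 'I_k -> 'I_M}) := [forall i : 'I_k, (ext w i.+1 < ext w i)%N].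
pose E (w : {ffun 'I_k -> 'I_M}) (i : 'I_k) (q : 'I_M) :=
  (step_down (ext w) i q)%:R * (link v (l i) q (l i.+1) / b q).
(* First order: remove the letter, then apply the induction hypothesis to m and read the strip from
   w by [steps_down]. When m does not interlace with l, so that the hypothesis may not apply, both
   sides are 0. *)
have below (m : {ffun 'I_k -> 'I_M}) : \prod_(r < k) u r *
    (\prod_(i < k) link v (l i) (m i) (l i.+1) * branch_sum k (ext m)) =
    \sum_w (dec w)%:R * (\prod_(i < k) E w i (m i)) * branch_sum k (ext w).
  have EE w : \prod_(i < k) E w i (m i) =
      [forall i : 'I_k, step_down (ext w) i (m i)]%:R *
      (\prod_(i < k) link v (l i) (m i) (l i.+1) / \prod_(i < k) b (m i)).
    by rewrite -prod_natr_bool -prodf_div -big_split.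
  have [e0 | nz] := eqVneq (\prod_(i < k) link v (l i) (m i) (l i.+1)) 0.
    rewrite e0 mul0r mulr0 big1 // => w _.
    by rewrite EE e0 mul0r !mulr0 mul0r.
  have mid := interlace nz; have m_str := interlace_strict l_str mid.
  have m_lt i : (i < k)%N -> ((ext m i).+1 < M)%N.
    move=> lt_ik; have /andP [_ lt] := mid i lt_ik.
    by apply: leq_ltn_trans lt (ltnW (l_lt i (ltnW lt_ik))).
  rewrite mulrCA (IHk _ m_str m_lt) mulrA mulr_sumr; apply: eq_bigr => w _.
  rewrite mulrA; congr (_ * _).
  have -> : \prod_(i < k) (step (ext m) i (w i))%:R =
      (dec w)%:R * [forall i : 'I_k, step_down (ext w) i (m i)]%:R :> K.
    rewrite prod_natr_bool -natrM mulnb; congr (nat_of_bool _)%:R.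
    have -> : [forall i : 'I_k, step (ext m) i (w i)] =
        [forall i : 'I_k, step (ext m) i (ext w i)].
      by apply: eq_forallb => i; rewrite ext_ord.
    rewrite (steps_down l_str (ext_out w (leqnn k)) mid); congr (_ && _).
    by apply: eq_forallb => i; rewrite ext_ord.
  have -> : \prod_(i < k) b (ext m i) = \prod_(i < k) b (m i).
    by apply: eq_bigr => i _; rewrite ext_ord.
  rewrite EE.
  by rewrite mulrC -!mulrA.
(* Second order: add the strip to l, then remove the letter down to w. *)
have above (w : {ffun 'I_k -> 'I_M}) :
    \sum_(q : {ffun 'I_k.+1 -> 'I_M}) (\prod_(i < k.+1) (step l i (q i))%:R) *
    (\prod_(i < k) link v (ext q i) (w i) (ext q i.+1) * strip v 0 (ext q k)) =
    \prod_(i < k.+1) Sterm v l (ext w) i.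
  rewrite /Sterm /Ssum bigA_distr_bigA /=; apply: eq_bigr => q _.
  rewrite big_split /=; have [-> | nz] := eqVneq (\prod_(i < k.+1) (step l i (q i))%:R) (0 : K).
    by rewrite !mul0r.
  congr (_ * _); under eq_bigr do rewrite linkE.
  have q_gt0 : (0 < ext q k)%N.
    move: nz => /prodf_neq0 /(_ ord_max isT); have := l_str.1 k (ltnSn k).
    rewrite -[X in ext q X]/(val (@ord_max k)) ext_ord /step /=.
    case: (posnP (q ord_max)) => // ->; case: (l k) => [|lk] //= _.
    by rewrite eqxx.
  rewrite !big_split /= [X in _ = X * _]big_ord_recr [X in _ = _ * X]big_ord_recl /=.
  rewrite mul1r (ext_out w (leqnn k)).
  have -> : colfac v (q ord_max) 0 = strip v 0 (ext q k).
    have e : nat_of_ord (q ord_max) = ext q k.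
      by rewrite -[X in ext q X]/(val (@ord_max k)) ext_ord.
    by rewrite /colfac e q_gt0.
  rewrite mulrAC; congr (_ * _ * _); apply: eq_bigr => i _.
    by rewrite ext_ord (@extE _ _ q (widen_ord (leqnSn k) i)).
  by rewrite add0n ext_ord (@extE _ _ q (lift ord0 i)).
(* The first order reduces to this sum over w through [below]; [row_exchange] identifies it with the
   second. *)
transitivity (v * strip v 0 (l k) * \sum_(w : {ffun 'I_k -> 'I_M})
    (dec w)%:R * (\prod_(i < k) Uterm v l (ext w) i) * branch_sum k (ext w)).
  rewrite big_ord_recr /= -/v mulr_sumr.
  have UE w : \prod_(i < k) Uterm v l (ext w) i =
      \sum_(m : {ffun 'I_k -> 'I_M}) \prod_(i < k) E w i (m i).
    by rewrite -(bigA_distr_bigA (E w)); apply: eq_bigr => i _.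
  transitivity (\sum_(m : {ffun 'I_k -> 'I_M}) v * strip v 0 (l k) *
      \sum_(w : {ffun 'I_k -> 'I_M})
        (dec w)%:R * (\prod_(i < k) E w i (m i)) * branch_sum k (ext w)).
    apply: eq_bigr => m _; rewrite -below; ring.
  rewrite [RHS]mulr_sumr.
  under [RHS]eq_bigr => w _ do rewrite UE mulr_sumr mulr_suml mulr_sumr.
  rewrite [RHS]exchange_big; apply: eq_bigr => m _ /=.
  by rewrite mulr_sumr; apply: eq_bigr => w _; ring.
apply: (mulfI bl_neq0); rewrite mulVKf //.
transitivity (\sum_(w : {ffun 'I_k -> 'I_M})
  (\prod_(i < k.+1) Sterm v l (ext w) i) * branch_sum k (ext w)).
  rewrite !mulr_sumr; apply: eq_bigr => w _.
  rewrite (row_exchange v l_str) => [|i le_ik|i lt_ik|].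
  - by rewrite -/(dec w); case: (dec w); rewrite ?mul0r ?mulr0 // /=; ring.
  - exact: l_lt.
  - by rewrite -[i]/(val (Ordinal lt_ik)) ext_ord.
  - exact: ext_out.
under eq_bigr do rewrite -above mulr_suml.
rewrite exchange_big; apply: eq_bigr => q _ /=.
by rewrite mulr_sumr; apply: eq_bigr => w _; ring.
Qed.

Lemma strip_eq0 v p q j : (p < j < q)%N -> v * b j = 1 -> strip v p q = 0.
Proof.
move=> /andP [lt_pj lt_jq] e; apply/eqP; rewrite prodf_seq_eq0; apply/hasP.
by exists j; rewrite ?mem_index_iota ?lt_pj // e subrr /=.
Qed.

Lemma strip_neq0 v p q : (forall j, (p < j < q)%N -> v * b j != 1) -> strip v p q != 0.
Proof.
move=> nz; rewrite prodf_seq_neq0; apply/allP => j; rewrite mem_index_iota => /nz.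
by rewrite subr_eq0.
Qed.

(* At a dual point a strip containing the position q k has weight 0, so in a
   non-zero term of the branching recursion no strip crosses q k. *)
Section Vanishing.

Variable q : nat -> nat.

(** The equation is x_(r+1) = (-) a_(q r), seen through t -> 1 + beta t. *)
Definition dual_point k : Prop :=
  forall r, (r < k)%N -> [/\ (0 < q r)%N, u r * b (q r) = 1
    & (0 < r)%N -> (q r.-1 < q r)%N].

Lemma dual_pointS k : dual_point k.+1 -> dual_point k.
Proof. by move=> dp r lt_rk; apply: dp; apply: ltnW. Qed.

Lemma term_neq0 k l (m : {ffun 'I_k -> 'I_M}) : strict k.+1 l ->
  (\prod_(i < k) link (u k) (l i) (m i) (l i.+1)) * strip (u k) 0 (l k)
      * branch_sum k (ext m) != 0 ->
  [/\ forall i, (i < k)%N -> (l i.+1 <= ext m i < l i)%N,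
      forall i, (i < k)%N -> strip (u k) (ext m i) (l i) != 0,
      strip (u k) 0 (l k) != 0 & branch_sum k (ext m) != 0].
Proof.
move=> l_str; rewrite !mulf_eq0 !negb_or -andbA => /and3P [nz -> ->]; split=> //.
  exact: interlace nz.
move=> i lt_ik; move/prodf_neq0: nz => /(_ (Ordinal lt_ik) isT) /=.
rewrite -(@extE _ _ m (Ordinal lt_ik) i) // /link.
by case: ifP; rewrite ?eqxx // mulf_eq0 negb_or => _ /andP [].
Qed.

(** Lower rows inherit the bound from m through l i.+1 <= m i. Only the first row uses the
    vanishing: its strip starts at m 0 <= q k.-1 < q k, so it cannot go past q k. *)
Lemma branch_sum_vanish k l : strict k l -> dual_point k -> branch_sum k l != 0 ->
  forall i, (i < k)%N -> (l i <= q (k.-1 - i))%N.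
Proof.
elim: k l => [//|k IHk] l l_str dp /= nz.
have [m] : exists m : {ffun 'I_k -> 'I_M},
  (\prod_(i < k) link (u k) (l i) (m i) (l i.+1)) * strip (u k) 0 (l k)
      * branch_sum k (ext m) != 0.
  apply/existsP; apply: contraR nz; rewrite negb_exists => /forallP z.
  by rewrite big1 // => m _; apply/eqP/negPn.
case/(term_neq0 l_str) => mid sm s0 Hm.
have m_le := IHk _ (interlace_strict l_str mid) (dual_pointS dp) Hm.
have [qk_gt0 uk qk] := dp k (ltnSn k).
case=> [|i] lt_ik; last first.
  have /andP [le _] := mid i lt_ik; apply: leq_trans le _.
  by have := m_le i lt_ik; rewrite subnS predn_sub.
rewrite subn0 leqNgt; apply/negP => lt.
have [k0 | k_gt0] := posnP k.
  by case/eqP: s0; apply: strip_eq0 uk; rewrite qk_gt0; move: lt; rewrite k0.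
case/eqP: (sm 0%N k_gt0); apply: strip_eq0 uk; rewrite lt andbT.
by apply: leq_ltn_trans (m_le 0%N k_gt0) _; rewrite subn0 qk.
Qed.

Hypothesis b_inj : forall i j, (0 < i)%N -> (0 < j)%N -> b i = b j -> i = j.

(** Only the term m i = l i.+1 survives: interlacing bounds m from below, [branch_sum_vanish] from
    above. Its strips stop before l 0 = q k, so injectivity of b keeps their factors non-zero. *)
Lemma branch_sum_diag k l : strict k l -> dual_point k ->
  (forall i, (i < k)%N -> (l i < M)%N) ->
  (forall i, (i < k)%N -> l i = q (k.-1 - i)) -> branch_sum k l != 0.
Proof.
elim: k l => [|k IHk] l l_str dp l_lt lq /=; first exact: oner_neq0.
have l_ltS (i : 'I_k) : (l i.+1 < M)%N by exact: (l_lt i.+1 (ltn_ord i)).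
have [_ uk _] := dp k (ltnSn k).
pose m0 : {ffun 'I_k -> 'I_M} := [ffun i => Ordinal (l_ltS i)].
have m0E i : (i < k)%N -> ext m0 i = l i.+1.
  by move=> lt_ik; rewrite -[i in LHS]/(val (Ordinal lt_ik)) ext_ord ffunE.
have lqS i : (i < k)%N -> l i.+1 = q (k.-1 - i)%N.
  by move=> lt_ik; rewrite lq //= subnS predn_sub.
have l_le i : (i <= k)%N -> (l i <= l 0)%N.
  elim: i => // i IHi lt_ik; apply: leq_trans (IHi (ltnW lt_ik)).
  exact/ltnW/(l_str.2 i).
have strip_nz p i : (i <= k)%N -> strip (u k) p (l i) != 0.
  move=> le_ik; apply: strip_neq0 => j /andP [lt_pj lt_jl].
  have j_gt0 : (0 < j)%N by apply: leq_ltn_trans lt_pj.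
  have uk_nz : u k != 0.
    by apply/eqP => uk0; move/eqP: uk; rewrite uk0 mul0r eq_sym oner_eq0.
  apply/eqP; rewrite -uk => /(mulfI uk_nz) /b_inj e.
  have := leq_trans lt_jl (l_le i le_ik).
  by rewrite lq // subn0 -e ?ltnn //; have [] := dp k (ltnSn k).
rewrite (bigD1 m0) //= [X in _ + X]big1 ?addr0 => [|m ne]; last first.
  apply: contraNeq ne => /(term_neq0 l_str) [mid _ _ Hm].
  have m_le := branch_sum_vanish (interlace_strict l_str mid) (dual_pointS dp) Hm.
  apply/eqP/ffunP => i; apply: val_inj; rewrite /= -!ext_ord m0E //.
  apply/eqP; rewrite eqn_leq lqS // m_le //= -lqS //.
  by have /andP [] := mid i (ltn_ord i).
rewrite !mulf_neq0 ?strip_nz //.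
  apply/prodf_neq0 => i _; rewrite ffunE /link /= leqnn ltnn mulr1 l_str.2 ?ltnS ?ltn_ord //.
  by rewrite strip_nz // ltnW.
have m0_str : strict k (ext m0).
  case: l_str => l_gt0 l_decr; split=> i lt_ik; first by rewrite m0E ?l_gt0.
  by rewrite !m0E ?l_decr // ltnW.
apply: IHk => // [|i lt_ik|i lt_ik]; first exact: dual_pointS.
  by rewrite m0E ?l_lt.
by rewrite m0E ?lqS.
Qed.

End Vanishing.

End Transfer.

(** * From set-valued tableaux to the branching recursion *)

Lemma prod_row (R : comPzSemiRingType) M p q t (z w : nat -> R) :
  (p <= q <= M)%N ->
  \prod_(0 <= j < M) (if (p <= j < q)%N then z j
                      else if (j.+1 == p) && t then w j else 1) =
  \prod_(p <= j < q) z j * (if (0 < p)%N && t then w p.-1 else 1).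
Proof.
move=> /andP [le_pq le_qM].
rewrite (@big_cat_nat _ _ _ p) ?(leq_trans le_pq) //=.
rewrite [X in _ * X](@big_cat_nat _ _ _ q) //= [X in _ * (_ * X)]big1_seq; last first.
  move=> j /andP [_]; rewrite mem_index_iota => /andP [le_qj _].
  by rewrite [(j < q)%N]ltnNge le_qj andbF gtn_eqF // ltnS (leq_trans le_pq).
rewrite mulr1 mulrC; congr (_ * _).
  by apply: eq_big_nat => j /andP [-> ->].
case: p le_pq => [|p] le_pq; first by rewrite big_geq.
rewrite big_nat_recr //= eqxx ltnn big1_seq ?mul1r // => j /andP [_].
by rewrite mem_index_iota => /andP [_ lt]; rewrite ltnNge (ltnW lt) /= ltn_eqF.
Qed.

Section Tableaux.

Variables (n M : nat).

(* Tableaux of all shapes are fillings of one rectangle, empty outside the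
   shape. *)
Definition filling : finType := {ffun 'I_n * 'I_M -> {set 'I_n}}.

Implicit Types (T : filling) (s lam mu : nat -> nat) (A : {set 'I_n * 'I_M}).

(** The bound [r < k] restricts the alphabet, for the induction on variables; [i <= r] makes the
    truncated index in [cell_weight] exact. *)
Definition tableau k s T : bool :=
  [forall i, forall j,
    [&& (T (i, j) != set0) == (j < s i)%N,
        [forall r in T (i, j), (i <= r < k)%N],
        [forall j' : 'I_M, (val j' == j.+1) ==>
          [forall r in T (i, j), forall r' in T (i, j'), (r <= r')%N]]
      & [forall i' : 'I_n, (val i' == i.+1) ==>
          [forall r in T (i, j), forall r' in T (i', j), (r < r')%N]]]].

Definition tableau_spec k s T : Prop :=
  [/\ forall i j, (T (i, j) != set0) = (j < s i)%N,
      forall i j r, r \in T (i, j) -> (i <= r < k)%N,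
      forall i (j j' : 'I_M) r r', j' = j.+1 :> nat ->
        r \in T (i, j) -> r' \in T (i, j') -> (r <= r')%N
    & forall (i i' : 'I_n) j r r', i' = i.+1 :> nat ->
        r \in T (i, j) -> r' \in T (i', j) -> (r < r')%N].

Lemma tableauP k s T : reflect (tableau_spec k s T) (tableau k s T).
Proof.
apply: (iffP 'forall_forallP) => [tabT | [nz rg row col] i j].
  split=> [i j | i j r rT | i j j' r r' e rT rT' | i i' j r r' e rT rT'].
  - by have /and4P [/eqP] := tabT i j.
  - by have /and4P [_ /forall_inP /(_ r rT)] := tabT i j.
  - have /and4P [_ _ /forallP /(_ j') /implyP h _] := tabT i j.
    have /forall_inP /(_ r rT) /forall_inP := h (introT eqP e).
    exact.
  - have /and4P [_ _ _ /forallP /(_ i') /implyP h] := tabT i j.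
    have /forall_inP /(_ r rT) /forall_inP := h (introT eqP e).
    exact.
apply/and4P; split.
- by rewrite nz.
- by apply/forall_inP => r /rg.
- apply/forallP => j'; apply/implyP => /eqP e.
  by apply/forall_inP => r rT; apply/forall_inP => r' rT'; apply: row e rT rT'.
- apply/forallP => i'; apply/implyP => /eqP e.
  by apply/forall_inP => r rT; apply/forall_inP => r' rT'; apply: col e rT rT'.
Qed.

Lemma card_ord_lt p : (p <= M)%N -> #|[set j : 'I_M | (j < p)%N]| = p.
Proof.
move=> le_pM; rewrite -[RHS]card_ord -(@card_imset _ _ (widen_ord le_pM)); last first.
  by move=> i j /(congr1 val) /= /val_inj.
apply: eq_card => j; rewrite inE; apply/idP/imsetP => [lt_jp | [j' _ ->]] /=.
  by exists (Ordinal lt_jp); last apply: val_inj.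
exact: ltn_ord.
Qed.

Lemma initial_segment (S : {set 'I_M}) :
  (forall j j' : 'I_M, val j' = j.+1 -> j' \in S -> j \in S) ->
  forall j, (j \in S) = (j < #|S|)%N.
Proof.
move=> down; have {}down (j j' : 'I_M) : (j <= j')%N -> j' \in S -> j \in S.
  case: j j' => j jM [j' j'M] /=; elim: j' j'M => [|j' IHj'] j'M le_jj'.
    by move=> h; rewrite (_ : Ordinal jM = Ordinal j'M) //; apply: val_inj => /=; lia.
  move=> jS; move: le_jj'; rewrite leq_eqVlt => /orP [/eqP e | lt].
    by rewrite (_ : Ordinal jM = Ordinal j'M) //; apply: val_inj.
  by apply: (IHj' (ltnW j'M)) => //; apply: down jS.
move=> j; apply/idP/idP => [jS | ].
  rewrite -[j.+1](@card_ord_lt j.+1) // subset_leq_card //.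
  by apply/subsetP => j'; rewrite inE ltnS => /down; apply.
apply: contraTT => jNS; rewrite -leqNgt -[X in (_ <= X)%N](@card_ord_lt j (ltnW _)) //.
rewrite subset_leq_card //; apply/subsetP => j' j'S; rewrite inE ltnNge.
by apply: contra jNS => /down; apply.
Qed.

Definition peel (kk : 'I_n) T : filling := [ffun c => T c :\ kk].
Definition last_letter (kk : 'I_n) T : {set 'I_n * 'I_M} := [set c | kk \in T c].
Definition add_letter (kk : 'I_n) T A : filling :=
  [ffun c => if c \in A then kk |: T c else T c].
Definition row_size T (i : 'I_n) : nat := #|[set j | T (i, j) != set0]|.

(* Removing the last letter kk from a tableau of shape lam leaves a tableau of
   some shape mu; kk occupies all of lam / mu, and any subset of the corners of
   mu with no box of lam underneath. *)
Section Peel.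

Variables (kk : 'I_n) (lam : nat -> nat).
Hypothesis lam_decr : forall i, (lam i.+1 <= lam i)%N.
Hypothesis lam_out : forall i, (kk < i)%N -> lam i = 0%N.
Hypothesis lam_le : forall i, (lam i <= M)%N.

Definition inner mu (c : 'I_n * 'I_M) : bool := (mu c.1 <= c.2 < lam c.1)%N.
Definition corner mu (c : 'I_n * 'I_M) : bool :=
  (c.2.+1 == mu c.1) && (lam c.1.+1 < mu c.1)%N.
Definition admissible mu A : bool :=
  [forall c, (inner mu c ==> (c \in A)) && ((c \in A) ==> inner mu c || corner mu c)].

(** If a box keeps a letter smaller than kk, so does its left neighbour: the surviving boxes of a
    row form an initial segment. *)
Lemma peel_row_size T i j : tableau kk.+1 lam T ->
  (peel kk T (i, j) != set0) = (j < row_size (peel kk T) i)%N.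
Proof.
case/tableauP => nz rg row col.
rewrite -(@initial_segment [set j | peel kk T (i, j) != set0]) ?inE // => j1 j2 e.
rewrite !inE => /set0Pn [r]; rewrite ffunE !inE => /andP [ne rT].
have : T (i, j1) != set0.
  have : T (i, j2) != set0 by apply/set0Pn; exists r.
  by rewrite !nz e; lia.
case/set0Pn => r1 r1T; apply/set0Pn; exists r1; rewrite ffunE !inE r1T andbT.
have := row _ _ _ _ _ e r1T rT; have := rg _ _ _ rT.
by move: ne; rewrite -!val_eqE /=; lia.
Qed.

Lemma row_size_le T i : tableau kk.+1 lam T -> (row_size (peel kk T) i <= lam i)%N.
Proof.
case/tableauP => nz _ _ _; rewrite -(@card_ord_lt (lam i)) // subset_leq_card //.
apply/subsetP => j; rewrite !inE -nz => /set0Pn [r].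
by rewrite ffunE !inE => /andP [_ rT]; apply/set0Pn; exists r.
Qed.

(** Above a box of lam all letters are smaller than some letter at most kk, hence survive the
    peeling. *)
Lemma row_size_ge T (i : 'I_n) : tableau kk.+1 lam T ->
  (lam i.+1 <= row_size (peel kk T) i)%N.
Proof.
move=> tabT; have [nz rg row col] := tableauP _ _ _ tabT.
rewrite -(@card_ord_lt (lam i.+1)) // subset_leq_card //.
apply/subsetP => j; rewrite !inE => lt_j.
have lt_ik : (i < kk)%N by rewrite ltnNge; apply: contraL lt_j => le; rewrite lam_out ?ltnS.
have lt_in := leq_ltn_trans lt_ik (ltn_ord kk).
have : T (Ordinal lt_in, j) != set0 by rewrite nz.
have : T (i, j) != set0 by rewrite nz; apply: leq_trans lt_j (lam_decr i).
case/set0Pn => r rT /set0Pn [r' r'T]; apply/set0Pn; exists r.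
rewrite ffunE !inE rT andbT -val_eqE /= neq_ltn.
have := @col i (Ordinal lt_in) j r r' erefl rT r'T; have := rg _ _ _ r'T.
by lia.
Qed.

Lemma tableau_add_letter mu T A :
  (forall i, mu i <= lam i)%N -> (forall i, lam i.+1 <= mu i)%N ->
  tableau kk mu T -> admissible mu A -> tableau kk.+1 lam (add_letter kk T A).
Proof.
move=> le_mu ge_mu /tableauP [nz rg row col] /forallP adm.
have upper i j : (i, j) \in A -> inner mu (i, j) || corner mu (i, j).
  by move=> cA; have /andP [_ /implyP] := adm (i, j); apply.
have lower i j : inner mu (i, j) -> (i, j) \in A.
  by have /andP [/implyP] := adm (i, j).
have memE i j r : (r \in add_letter kk T A (i, j)) =
    (((i, j) \in A) && (r == kk)) || (r \in T (i, j)).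
  by rewrite ffunE; case: ifP => _; rewrite ?inE.
have T_lt i j r : r \in T (i, j) -> (j < mu i)%N.
  by move=> rT; rewrite -nz; apply/set0Pn; exists r.
have A_lt i j : (i, j) \in A -> (j < lam i)%N.
  by move/upper; rewrite /inner /corner /=; have := le_mu i; lia.
apply/tableauP; split=> [i j | i j r | i j j' r r' e | i i' j r r' e]; rewrite ?memE.
- apply/set0Pn/idP => [[r] | lt_j].
    rewrite memE => /orP [/andP [/A_lt] // | /T_lt lt].
    exact: leq_trans lt (le_mu i).
  have [le | lt] := leqP (mu i) j.
    by exists kk; rewrite memE lower ?eqxx //= /inner /= le lt_j.
  have : T (i, j) != set0 by rewrite nz.
  by case/set0Pn => r rT; exists r; rewrite memE rT orbT.
- case/orP => [/andP [/A_lt lt /eqP ->] | /rg /andP [-> lt]]; last exact: ltnW.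
  by rewrite leqnn andbT leqNgt; apply: contraL lt => lt; rewrite lam_out.
- move=> rT' /orP [/andP [_ /eqP ->] | r'T].
    case/orP: rT' => [/andP [_ /eqP -> //] | /rg /andP [_]]; exact: ltnW.
  case/orP: rT' => [/andP [/upper] | rT]; last exact: row e rT r'T.
  by rewrite /inner /corner /=; have := T_lt _ _ _ r'T; lia.
- move=> rT' /orP rT''; have rT : r \in T (i, j).
    case/orP: rT' => // /andP [/upper].
    have : (j < lam i')%N.
      case: rT'' => [/andP [/A_lt] // | /T_lt lt].
      exact: leq_trans lt (le_mu i').
    by rewrite /inner /corner /= e; have := ge_mu i; lia.
  case: rT'' => [/andP [_ /eqP ->] | r'T]; last exact: col e rT r'T.
  by have /andP [] := rg _ _ _ rT.
Qed.

Lemma tableau_peel mu T : (forall i : 'I_n, mu i = row_size (peel kk T) i) ->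
  tableau kk.+1 lam T -> tableau kk mu (peel kk T).
Proof.
move=> mu_i tabT; have [nz rg row col] := tableauP _ _ _ tabT.
apply/tableauP; split=> [i j | i j r | i j j' r r' e | i i' j r r' e].
- by rewrite peel_row_size // mu_i.
- rewrite ffunE !inE -val_eqE /= => /andP [ne /rg].
  by move: ne; lia.
- rewrite !ffunE !inE => /andP [_ rT] /andP [_]; exact: row e rT.
- rewrite !ffunE !inE => /andP [_ rT] /andP [_]; exact: col e rT.
Qed.

(** Since kk is the largest letter, only kk can stand to the right of a box containing it, and no
    box can lie underneath. *)
Lemma admissible_last mu T : (forall i : 'I_n, mu i = row_size (peel kk T) i) ->
  tableau kk.+1 lam T -> admissible mu (last_letter kk T).
Proof.
move=> mu_i tabT; have [nz rg row col] := tableauP _ _ _ tabT.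
have T_lt i j r : r \in T (i, j) -> (j < lam i)%N.
  by move=> rT; rewrite -nz; apply/set0Pn; exists r.
have lt_mu (i : 'I_n) (j : 'I_M) : (j < mu i)%N = (peel kk T (i, j) != set0).
  by rewrite peel_row_size // mu_i.
apply/forallP => [[i j]]; rewrite inE; apply/andP; split; apply/implyP.
  rewrite /inner /= leqNgt lt_mu negbK => /andP [/eqP e lt_j].
  have : T (i, j) != set0 by rewrite nz.
  case/set0Pn => r rT; have : r \notin peel kk T (i, j) by rewrite e inE.
  by rewrite ffunE !inE rT andbT negbK => /eqP <-.
move=> kT; have lt_j := T_lt _ _ _ kT; rewrite /inner /corner /= lt_j andbT.
have [//|lt_j' /=] := leqP (mu i) j; have := mu_i i; have := row_size_le i tabT => le_row eq_row.
apply/andP; split.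
  rewrite eqn_leq lt_j' leqNgt; apply/negP => lt_j1.
  have j1M : (j.+1 < M)%N by apply: leq_trans lt_j1 _; rewrite eq_row (leq_trans le_row).
  have := lt_mu i (Ordinal j1M); rewrite lt_j1 => /esym /set0Pn [r].
  rewrite ffunE !inE -val_eqE => /andP [ne rT].
  have := @row i j (Ordinal j1M) kk r erefl kT rT; have := rg _ _ _ rT.
  by move: ne => /=; lia.
rewrite ltnNge; apply/negP => le; have {le} lt1 := leq_trans lt_j' le.
have lt_ik : (i < kk)%N by rewrite ltnNge; apply: contraL lt1 => h; rewrite lam_out ?ltnS.
have lt_in := leq_ltn_trans lt_ik (ltn_ord kk).
have : T (Ordinal lt_in, j) != set0 by rewrite nz.
case/set0Pn => r rT; have := @col i (Ordinal lt_in) j kk r erefl kT rT.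
by have := rg _ _ _ rT; lia.
Qed.

End Peel.

Section Weights.

Variables (K : fieldType) (b u : nat -> K).

Definition cell_weight r (c : 'I_n * 'I_M) : K := u r * b (r.+1 + c.2 - c.1)%N - 1.

Definition weight T : K := \prod_c \prod_(r in T c) cell_weight r c.

Definition tableau_sum k s : K := \sum_(T | tableau k s T) weight T.

(** Expand a product of binomials over all cells: z c + 0 on inner cells (forced), z c + 1 on
    corners (optional), 0 + 1 elsewhere (excluded). *)
Lemma sum_admissible lam mu (z : 'I_n * 'I_M -> K) :
  \sum_(A | admissible lam mu A) \prod_(c in A) z c =
  \prod_c (if inner lam mu c then z c else if corner lam mu c then 1 + z c else 1).
Proof.
rewrite (eq_bigr (fun c => (if inner lam mu c || corner lam mu c then z c else 0)
  + (if inner lam mu c then 0 else 1))) => [|c _]; last first.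
  by case: (inner _ _ _) => /=; case: (corner _ _ _); rewrite ?addr0 ?add0r // addrC.
rewrite bigA_distr /= [RHS](bigID (admissible lam mu)) /= [X in _ = _ + X]big1 ?addr0.
  apply: eq_bigr => A /forallP adm; rewrite big_mkcond; apply: eq_bigr => c _.
  by have := adm c; case: (c \in A); case: (inner _ _ _) => //=; case: (corner _ _ _).
move=> A; case/forallPn => c; rewrite (bigD1 c) //=.
case: (c \in A); case: (inner _ _ _) => //=; rewrite ?mul0r //.
by case: (corner _ _ _); rewrite ?mul0r.
Qed.

Lemma weight_add_letter (kk : 'I_n) mu T A : tableau kk mu T ->
  weight (add_letter kk T A) = weight T * \prod_(c in A) cell_weight kk c.
Proof.
case/tableauP => _ rg _ _; rewrite [X in _ * X]big_mkcond -big_split /=.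
apply: eq_bigr => [[i j]] _; rewrite ffunE; case: ifP => _; last by rewrite mulr1.
rewrite big_setU1 1?mulrC //=; apply/negP => /rg.
by rewrite ltnn andbF.
Qed.

(** Inverse of the encoding by positions; the subtraction is exact for strict l, by [strict_ge]. *)
Definition shape_of k (l : nat -> nat) i : nat := if (i < k)%N then (l i - (k - i))%N else 0%N.

Lemma strict_ge k l i : strict k l -> (i < k)%N -> (k - i <= l i)%N.
Proof.
case=> l_gt0 l_decr lt_ik; have [d e] : exists d, k = (i + d).+1.
  by exists (k - i).-1; lia.
elim: d i lt_ik e => [|d IHd] i lt_ik e.
  by have := l_gt0 i lt_ik; lia.
have lt1 : (i.+1 < k)%N by lia.
by have := IHd i.+1 lt1; have := l_decr i lt1; lia.
Qed.

Section Branching.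

Variables (kk : 'I_n) (l m : nat -> nat).
Hypothesis l_str : strict kk.+1 l.
Hypothesis l_lt : forall i, (i <= kk)%N -> (l i <= M)%N.
Hypothesis mid : forall i, (i < kk)%N -> (l i.+1 <= m i < l i)%N.

Let lam := shape_of kk.+1 l.
Let mu := shape_of kk m.

Lemma shape_decr k f i : strict k f -> (shape_of k f i.+1 <= shape_of k f i)%N.
Proof.
move=> f_str; rewrite /shape_of; case: ltnP => // lt1; rewrite (ltnW lt1).
by have := f_str.2 i lt1; lia.
Qed.

Lemma shape_le i : (mu i <= lam i)%N.
Proof.
rewrite /mu /lam /shape_of; case: ltnP => // lt_ik; rewrite ltnS (ltnW lt_ik).
by have := mid lt_ik; lia.
Qed.

Lemma shape_ge i : (lam i.+1 <= mu i)%N.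
Proof.
rewrite /mu /lam /shape_of ltnS; case: ltnP => // lt_ik.
by have := mid lt_ik; lia.
Qed.

Lemma shape_bound i : (lam i <= M)%N.
Proof.
rewrite /lam /shape_of; case: ltnP => // lt_ik.
by have := l_lt lt_ik; lia.
Qed.

(** Shifting a column by kk.+1 - i gives its index in b: the inner columns become the positions
    strictly between m i and l i, and the corner column becomes m i. *)
Lemma prod_row_link (i : 'I_n) :
  \prod_(j < M) (if inner lam mu (i, j) then cell_weight kk (i, j)
    else if corner lam mu (i, j) then 1 + cell_weight kk (i, j) else 1) =
  if (i < kk)%N then link b (u kk) (l i) (m i) (l i.+1)
  else if (i == kk :> nat) then strip b (u kk) 0 (l kk) else 1.
Proof.
rewrite -(big_mkord predT (fun j =>
  if (mu i <= j < lam i)%N then u kk * b (kk.+1 + j - i)%N - 1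
  else if (j.+1 == mu i) && (lam i.+1 < mu i)%N
    then 1 + (u kk * b (kk.+1 + j - i)%N - 1) else 1)) /=.
rewrite (@prod_row _ M (mu i) (lam i) (lam i.+1 < mu i)%N
  (fun j => u kk * b (kk.+1 + j - i)%N - 1)
  (fun j => 1 + (u kk * b (kk.+1 + j - i)%N - 1))) ?shape_le ?shape_bound //.
have [lt_ik | lt_ki | e] := ltngtP i kk.
- have := mid lt_ik; have le_l := strict_ge l_str (lt_ik : (i.+1 < kk.+1)%N).
  move=> mid_i; have lt_ik1 := ltnW lt_ik.
  have e1 : mu i = (m i - (kk - i))%N by rewrite /mu /shape_of lt_ik.
  have e2 : lam i = (l i - (kk.+1 - i))%N by rewrite /lam /shape_of ltnS lt_ik1.
  have e3 : lam i.+1 = (l i.+1 - (kk - i))%N by rewrite /lam /shape_of ltnS lt_ik.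
  rewrite /link mid_i; congr (_ * _).
    rewrite /strip e1 e2.
    have -> : (m i).+1 = (m i - (kk - i) + (kk.+1 - i))%N by lia.
    rewrite big_addn; apply: eq_big_nat => j _; congr (_ * b _ - 1); lia.
  have -> : (0 < mu i)%N && (lam i.+1 < mu i)%N = (l i.+1 < m i)%N by lia.
  case: ifP => // lt; have -> : (kk.+1 + (mu i).-1 - i)%N = m i by lia.
  by ring.
- have e1 : mu i = 0%N by rewrite /mu /shape_of ltnNge ltnW.
  have e2 : lam i = 0%N by rewrite /lam /shape_of ltnNge lt_ki.
  by rewrite e1 e2 big_geq // mulr1.
have e1 : mu i = 0%N by rewrite /mu /shape_of e ltnn.
have e2 : lam i = (l kk - 1)%N by rewrite /lam /shape_of e ltnSn subSnn.
rewrite e1 e2 mulr1 /strip [RHS](big_addn 0 (l kk) 1%N); apply: eq_big_nat => j _.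
by congr (_ * b _ - 1); lia.
Qed.

Lemma prod_branch :
  \prod_c (if inner lam mu c then cell_weight kk c
    else if corner lam mu c then 1 + cell_weight kk c else 1) =
  (\prod_(i < kk) link b (u kk) (l i) (m i) (l i.+1)) * strip b (u kk) 0 (l kk).
Proof.
pose F c := if inner lam mu c then cell_weight kk c
    else if corner lam mu c then 1 + cell_weight kk c else 1.
transitivity (\prod_(i < n) \prod_(j < M) F (i, j)).
  by rewrite pair_bigA; apply: eq_bigr => [[i j] _].
under eq_bigr do rewrite prod_row_link.
rewrite -(big_mkord predT (fun i => if (i < kk)%N then link b (u kk) (l i) (m i) (l i.+1)
  else if (i == kk :> nat) then strip b (u kk) 0 (l kk) else 1)).
rewrite (@big_cat_nat _ _ _ kk) ?(ltnW (ltn_ord kk)) //= [X in _ * X]big_ltn // ltnn eqxx.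
rewrite [X in _ * (_ * X)]big1_seq ?mulr1 => [|i /andP [_]]; last first.
  by rewrite mem_index_iota => /andP [lt _]; rewrite ltnNge (ltnW lt) /= gtn_eqF.
congr (_ * _); rewrite -(big_mkord predT (fun i => link b (u kk) (l i) (m i) (l i.+1))).
by apply: eq_big_nat => i /andP [_ ->].
Qed.

End Branching.

Lemma peelK (kk : 'I_n) T : add_letter kk (peel kk T) (last_letter kk T) = T.
Proof.
apply/ffunP => c; apply/setP => r; rewrite !ffunE inE; case: ifP => kT; rewrite !inE.
  by have [->|] := eqVneq r kk; rewrite ?kT.
by have [->|] := eqVneq r kk; rewrite ?kT.
Qed.

Lemma peel_add (kk : 'I_n) k mu T A : (k <= kk)%N -> tableau k mu T ->
  peel kk (add_letter kk T A) = T /\ last_letter kk (add_letter kk T A) = A.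
Proof.
move=> le_k /tableauP [_ rg _ _].
have kT c : kk \notin T c.
  by case: c => i j; apply/negP => /rg /andP [_]; rewrite ltnNge le_k.
split; first (apply/ffunP => c; apply/setP => r); last apply/setP => c.
  rewrite !ffunE !inE; case: ifP => _; rewrite ?inE;
  by have [->|] := eqVneq r kk; rewrite ?(negbTE (kT _)).
by rewrite inE ffunE; case: ifP => cA; rewrite ?inE ?eqxx // (negbTE (kT _)).
Qed.

Lemma row_size_tableau k mu T (i : 'I_n) : (mu i <= M)%N -> tableau k mu T -> row_size T i = mu i.
Proof.
move=> le_M /tableauP [nz _ _ _]; rewrite -[RHS](card_ord_lt le_M).
by apply: eq_card => j; rewrite !inE nz.
Qed.

Lemma row_size_out (kk i : 'I_n) lam T : tableau kk.+1 lam T -> (kk <= i)%N ->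
  row_size (peel kk T) i = 0%N.
Proof.
case/tableauP => _ rg _ _ le_ki; apply/eqP; rewrite cards_eq0; apply/eqP/setP => j.
rewrite !inE; apply/negbTE; rewrite negbK; apply/eqP/setP => r.
rewrite ffunE !inE; apply/negP => /andP [ne /rg].
by move: ne; rewrite -val_eqE /=; lia.
Qed.

(** Tableaux are grouped by the shape left after peeling; a group corresponds to the pairs of a
    smaller tableau and an admissible set of boxes for the letter kk. *)
Lemma tableau_sum_step (kk : 'I_n) l :
  strict kk.+1 l -> (forall i, (i <= kk)%N -> (l i < M)%N) ->
  tableau_sum kk.+1 (shape_of kk.+1 l) =
  \sum_(m : {ffun 'I_kk -> 'I_M})
    (\prod_(i < kk) link b (u kk) (l i) (m i) (l i.+1)) * strip b (u kk) 0 (l kk)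
    * tableau_sum kk (shape_of kk (ext m)).
Proof.
move=> l_str l_lt; set lam := shape_of kk.+1 l.
have lam_decr i : (lam i.+1 <= lam i)%N by apply: shape_decr.
have lam_out i : (kk < i)%N -> lam i = 0%N by move=> lt; rewrite /lam /shape_of ltnNge lt.
have lam_le i : (lam i <= M)%N.
  by apply: shape_bound => j le_j; apply/ltnW/l_lt.
have lamE i : (i <= kk)%N -> lam i = (l i - (kk.+1 - i))%N.
  by rewrite /lam /shape_of ltnS => ->.
have M_gt0 : (0 < M)%N by apply: leq_ltn_trans (l_lt 0%N _).
pose row (i : 'I_kk) := widen_ord (ltnW (ltn_ord kk)) i.
(* The default of [insubd] is never reached on tableaux of shape lam, as [posE] shows. *)
pose pos T : {ffun 'I_kk -> 'I_M} :=
  [ffun i => insubd (Ordinal M_gt0) (row_size (peel kk T) (row i) + (kk - i))%N].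
pose Q (m : {ffun 'I_kk -> 'I_M}) := [forall i : 'I_kk, l i.+1 <= m i < l i]%N.
have posE T i : tableau kk.+1 lam T ->
    pos T i = (row_size (peel kk T) (row i) + (kk - i))%N :> nat.
  move=> tabT; rewrite ffunE val_insubd.
  have := @row_size_le kk lam lam_le T (row i) tabT.
  have := strict_ge l_str (ltnW (ltn_ord i) : (i < kk.+1)%N).
  rewrite /= (lamE _ (ltnW (ltn_ord i))).
  have := l_lt i (ltnW (ltn_ord i)); have := ltn_ord i.
  by case: ifP => //; lia.
rewrite /tableau_sum (partition_big pos Q) /= => [|T tabT]; last first.
  apply/forallP => i; rewrite posE //; have lt_ik := ltn_ord i.
  have := @row_size_le kk lam lam_le T (row i) tabT.
  have := row_size_ge lam_decr lam_out lam_le (row i) tabT.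
  rewrite /= (lamE _ lt_ik) (lamE _ (ltnW lt_ik)).
  have := strict_ge l_str (lt_ik : (i.+1 < kk.+1)%N).
  have := strict_ge l_str (ltnW lt_ik : (i < kk.+1)%N).
  by lia.
rewrite [RHS](bigID Q) /= [X in _ = _ + X]big1 ?addr0 => [|m]; last first.
  case/forallPn => i; rewrite (bigD1 i) //= {1}/link => /negbTE ->.
  by rewrite !mul0r.
apply: eq_bigr => m /forallP Qm; set mu := shape_of kk (ext m).
have mid i : (i < kk)%N -> (l i.+1 <= ext m i < l i)%N.
  by move=> lt_ik; rewrite (@extE _ _ m (Ordinal lt_ik)) //; apply: Qm.
have le_mu i : (mu i <= lam i)%N by apply: shape_le.
have ge_mu i : (lam i.+1 <= mu i)%N by apply: shape_ge.
rewrite (reindex_onto (fun p : filling * {set 'I_n * 'I_M} => add_letter kk p.1 p.2)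
  (fun T => (peel kk T, last_letter kk T))) => [|T _]; last exact: peelK.
rewrite (eq_bigl (fun p => tableau kk mu p.1 && admissible lam mu p.2)); last first.
  move=> [T A] /=; apply/andP/andP => [[/andP [tabX /eqP posX] /eqP [eT eA]] | [tabT admA]].
    set X := add_letter kk T A in tabX posX eT eA.
    have mu_row (i : 'I_n) : mu i = row_size (peel kk X) i.
      rewrite /mu /shape_of; case: ltnP => [lt_ik | le_ki]; last first.
        by rewrite (row_size_out tabX).
      rewrite (@extE _ _ m (Ordinal lt_ik)) // -posX posE // addnK.
      by congr row_size; apply: val_inj.
    rewrite -{1}eT -eA; split; first exact: (tableau_peel mu_row tabX).
    exact: (admissible_last lam_out lam_le mu_row tabX).
  have tabX := tableau_add_letter lam_out le_mu ge_mu tabT admA.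
  have [eT eA] := peel_add A (leqnn kk) tabT.
  rewrite tabX eT eA; split=> //; apply/eqP/ffunP => i; apply: val_inj.
  rewrite /= posE // eT (row_size_tableau _ tabT) ?(leq_trans (le_mu _)) //.
  rewrite /mu /shape_of /= ltn_ord (@extE _ _ m i) //.
  have := Qm i; have := strict_ge l_str (ltn_ord i : (i.+1 < kk.+1)%N); have := ltn_ord i.
  by lia.
rewrite -(pair_big (tableau kk mu) (admissible lam mu)
  (fun T A => weight (add_letter kk T A))) /= mulr_sumr.
apply: eq_bigr => T tabT; under eq_bigr do rewrite (weight_add_letter _ tabT).
rewrite -mulr_sumr sum_admissible // prod_branch // => [|i le_i]; last exact/ltnW/l_lt.
rewrite mulrC; congr (_ * _ * _); apply: eq_bigr => i _; by rewrite ext_ord.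
Qed.

Lemma tableau_sum_branch k l : (k <= n)%N -> strict k l ->
  (forall i, (i < k)%N -> (l i < M)%N) ->
  tableau_sum k (shape_of k l) = branch_sum b u M k l.
Proof.
elim: k l => [|k IHk] l le_kn l_str l_lt.
  rewrite /tableau_sum (big_pred1 [ffun=> set0]) => [|T].
    by rewrite /weight big1 // => c _; rewrite ffunE big_set0.
  apply/tableauP/eqP => [[nz _ _ _] | ->].
    apply/ffunP => [[i j]]; rewrite ffunE; apply/eqP.
    by rewrite -[_ == _]negbK nz.
  split=> [i j | i j r | i j j' r r' _ | i i' j r r' _]; rewrite ?ffunE ?inE //.
  by rewrite eqxx.
rewrite (@tableau_sum_step (Ordinal le_kn)) //=; apply: eq_bigr => m _.
have [-> | nz] := eqVneq (\prod_(i < k) link b (u k) (l i) (m i) (l i.+1)) 0.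
  by rewrite !mul0r.
have mid := interlace nz.
rewrite IHk //; [exact: ltnW | exact: interlace_strict mid | move=> i lt_ik].
have /andP [_ lt] := mid i lt_ik; apply: ltn_trans lt _.
exact/l_lt/ltnW.
Qed.

End Weights.

End Tableaux.

(** * Fillings of a rectangle versus set-valued tableaux on the boxes of a partition *)

Section Boxes.

Variables (n M : nat) (la : part n).
Hypothesis la_le : forall i, (la i <= M)%N.

Definition row_len (i : nat) : nat := nth 0%N la i.

Lemma row_lenE (i : 'I_n) : row_len i = la i.
Proof. by rewrite /row_len /part_at (tnth_nth 0%N). Qed.

Lemma box_lt (x : box la) : (box_col x < la (box_row x))%N.
Proof. by rewrite -mem_diagram /box_row /box_col -surjective_pairing ssvalP. Qed.

Lemma box_bound (x : box la) : (box_col x < M)%N.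
Proof. exact: leq_trans (box_lt x) (la_le _). Qed.

Definition cell_of (x : box la) : 'I_n * 'I_M :=
  (box_row x, Ordinal (box_bound x)).

Definition box_of (c : 'I_n * 'I_M) : option (box la) := insub (c.1, val c.2).

Lemma cell_ofK : pcancel cell_of box_of.
Proof.
move=> x; rewrite /box_of /=.
have -> : (box_row x, box_col x) = val x by rewrite /box_row /box_col -surjective_pairing.
by rewrite valK.
Qed.

Lemma box_ofP (c : 'I_n * 'I_M) :
  if (c.2 < la c.1)%N then exists2 x, c = cell_of x & box_of c = Some x
  else box_of c = None.
Proof.
rewrite /box_of; case: insubP => [x | ].
  rewrite mem_diagram => -> e; exists x => //.
  case: c e => i j /= e; congr (_, _); first by rewrite /box_row e.
  by apply: val_inj; rewrite /= /box_col e.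
by rewrite mem_diagram => /negbTE ->.
Qed.

Definition restrict (T : filling n M) : {ffun box la -> {set 'I_n}} :=
  [ffun x => T (cell_of x)].
Definition extend (T : {ffun box la -> {set 'I_n}}) : filling n M :=
  [ffun c => oapp T set0 (box_of c)].

Lemma extendK : cancel extend restrict.
Proof. by move=> T; apply/ffunP => x; rewrite !ffunE cell_ofK. Qed.

Lemma restrict_tableau T :
  set_valued_tableau (restrict T) && (extend (restrict T) == T) = tableau n row_len T.
Proof.
apply/andP/tableauP => [[/and3P [/forallP nz /forallP lf /forallP ab] /eqP eT] |].
  have T_out i (j : 'I_M) : ~~ (j < la i)%N -> T (i, j) = set0.
    have := box_ofP (i, j) => /=; case: ifP => // _ e _.
    by rewrite -eT ffunE e.
  have box i (j : 'I_M) : (j < la i)%N -> exists2 x, (i, j) = cell_of x & restrict T x = T (i, j).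
    have := box_ofP (i, j) => /=; case: ifP => // _ [x e _] _.
    by exists x; rewrite // ffunE e.
  have T_in i (j : 'I_M) r : r \in T (i, j) -> (j < la i)%N.
    by move=> rT; apply: contraLR rT => /T_out ->; rewrite inE.
  have col (i i' : 'I_n) (j : 'I_M) r r' : i' = i.+1 :> nat ->
      r \in T (i, j) -> r' \in T (i', j) -> (r < r')%N.
    move=> e rT rT'; have [x ex Tx] := box _ _ (T_in _ _ _ rT).
    have [x' ex' Tx'] := box _ _ (T_in _ _ _ rT').
    have /forallP /(_ x') /implyP := ab x; rewrite Tx Tx'.
    case: ex ex' => ei ej [ei' ej'].
    rewrite /above -ei -ei' /= e eqxx /=.
    move: ej => /(congr1 val) /= <-; move: ej' => /(congr1 val) /= <-.
    by move=> /(_ (eqxx _)) /forall_inP /(_ r rT) /forall_inP /(_ r' rT').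
  split=> // [i j | i j r rT | i j j' r r' e rT rT'].
  - have [lt | out] := boolP (j < la i)%N; last first.
      by rewrite T_out // eqxx row_lenE (negbTE out).
    by have [x _ <-] := box i j lt; rewrite nz row_lenE lt.
  (* The bound i <= r is not part of [set_valued_tableau]; strictness down the column, starting from
     row 0, forces it. *)
  - rewrite ltn_ord andbT; move: i rT => [i lt_in].
    elim: i lt_in r => // i IHi lt_in r rT.
    have lt_in' := ltnW lt_in.
    have : (j < la (Ordinal lt_in'))%N.
      by apply: leq_trans (T_in _ _ _ rT) _; apply: part_geq => /=.
    case/box => x _ Tx; have := nz x; rewrite Tx => /set0Pn [r' r'T].
    apply: leq_ltn_trans (IHi _ _ r'T) _.
    exact: (@col (Ordinal lt_in') (Ordinal lt_in) j).
  - have [x ex Tx] := box _ _ (T_in _ _ _ rT).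
    have [x' ex' Tx'] := box _ _ (T_in _ _ _ rT').
    have /forallP /(_ x') /implyP := lf x; rewrite Tx Tx'.
    case: ex ex' => ei ej [ei' ej'].
    rewrite /left_of -ei -ei' eqxx /=.
    move: ej => /(congr1 val) /= <-; move: ej' => /(congr1 val) /= <-.
    move=> /(_ (introT eqP e)) /forall_inP /(_ r rT) /forall_inP; exact.
case=> nz rg row col; split.
  apply/and3P; split; apply/forallP => x.
  - by rewrite ffunE /cell_of nz row_lenE box_lt.
  - apply/forallP => x'; apply/implyP => /andP [/eqP ei /eqP ej].
    apply/forall_inP => r; rewrite ffunE => rT; apply/forall_inP => r'.
    rewrite ffunE /cell_of ei => r'T; apply: row rT r'T => /=; exact: ej.
  apply/forallP => x'; apply/implyP => /andP [/eqP ei /eqP ej].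
  apply/forall_inP => r; rewrite ffunE => rT; apply/forall_inP => r'.
  rewrite ffunE => r'T; apply: (@col _ (box_row x') _ _ _ ei rT).
  by rewrite (_ : Ordinal _ = Ordinal (box_bound x')) //; apply: val_inj.
apply/eqP/ffunP => [[i j]]; rewrite ffunE.
have := box_ofP (i, j) => /=; case: ifP => [_ [x -> ->] | out ->] /=; first by rewrite ffunE.
by apply/esym/eqP; rewrite -[_ == _]negbK nz row_lenE out.
Qed.

Lemma prod_box (R : comPzSemiRingType) (G : 'I_n * 'I_M -> R) :
  (forall c : 'I_n * 'I_M, ~~ (c.2 < la c.1)%N -> G c = 1) ->
  \prod_(x : box la) G (cell_of x) = \prod_c G c.
Proof.
move=> G1; rewrite [RHS](bigID (fun c : 'I_n * 'I_M => (c.2 < la c.1)%N)) /=.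
rewrite [X in _ = _ * X]big1 // mulr1.
rewrite (reindex_omap cell_of box_of) /= => [|c lt]; last first.
  by have := box_ofP c; rewrite lt => -[x -> ->].
apply: eq_bigl => x; rewrite cell_ofK eqxx andbT; exact/esym/box_lt.
Qed.

End Boxes.

Section Evaluation.

Variables (K : fieldType) (n : nat) (beta : K) (a : nat -> K).
Hypothesis beta_neq0 : beta != 0.

Definition bshift j : K := 1 + beta * a j.
Definition ushift (x : 'I_n -> K) r : K := 1 + beta * oapp x 0 (insub r).

(** Boxes being non-empty, |T| >= |la|, so the powers of beta combine to beta ^ |T|: one beta for
    each letter, turning x (+) a into a [cell_weight]. *)
Lemma meval_grothendieck M (la : part n) (x : 'I_n -> K) :
  (forall i, la i <= M)%N ->
  beta ^+ size (diagram la) * (grothendieck beta a la).@[x] =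
  tableau_sum n M bshift (ushift x) n (row_len la).
Proof.
move=> la_le.
rewrite /grothendieck rmorph_sum /= mulr_sumr.
rewrite (reindex_onto (restrict la_le) (@extend n M la)) => [|T _]; last exact: extendK.
rewrite (eq_bigl _ _ (restrict_tableau la_le)); apply: eq_bigr => T tabT.
have := tabT; rewrite -(restrict_tableau la_le) => /andP [/and3P [/forallP nz _ _] _].
have [nzT _ _ _] := tableauP _ _ _ tabT.
rewrite rmorphM rmorph_prod /= mevalC mulrA -exprD subnKC; last first.
  rewrite -(card_seq_sub (diagram_uniq la)) -sum1_card.
  by apply: leq_sum => X _; rewrite card_gt0.
pose G (c : 'I_n * 'I_M) := \prod_(r in T c) cell_weight bshift (ushift x) r c.
rewrite /weight -(@prod_box _ _ _ la_le _ G) => [|[i j] /= out]; last first.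
  rewrite /G big1 // => r rT; case/negP: out; rewrite -row_lenE -nzT.
  by apply/set0Pn; exists r.
rewrite /tableau_size expr_sum -big_split /=; apply: eq_bigr => X _.
rewrite /G -prodr_const rmorph_prod /= -big_split /= ffunE; apply: eq_bigr => r _.
rewrite /cell_weight /bshift /ushift valK /= /oplus.
rewrite !rmorphD !rmorphM /= !mevalC mevalXU; ring.
Qed.

End Evaluation.

(** * Rook strips and the Pieri rule *)

Section Positions.

Variable n : nat.
Implicit Types (la mu nu : part n).

Definition pos la i : nat := (row_len la i + (n - i))%N.

Lemma row_len_out la i : (n <= i)%N -> row_len la i = 0%N.
Proof. by move=> le_ni; rewrite /row_len nth_default // size_tuple. Qed.

Lemma posE la (i : 'I_n) : pos la i = (n - i + la i)%N.
Proof. by rewrite /pos row_lenE addnC. Qed.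

Lemma row_len_decr la i : (row_len la i.+1 <= row_len la i)%N.
Proof.
have [lt | le] := ltnP i.+1 n; last by rewrite (row_len_out la le).
rewrite -[i.+1]/(nat_of_ord (Ordinal lt)) -[i in (_ <= _ i)%N]/(nat_of_ord (Ordinal (ltnW lt))).
by rewrite !row_lenE part_geq //=.
Qed.

Lemma pos_strict la : strict n (pos la).
Proof.
split=> i lt_in; first by rewrite addn_gt0 subn_gt0 lt_in orbT.
by have := row_len_decr la i; rewrite /pos; lia.
Qed.

Lemma shape_of_pos la i : shape_of n (pos la) i = row_len la i.
Proof.
by rewrite /shape_of /pos; case: ltnP => [_ | /row_len_out -> //]; rewrite addnK.
Qed.

Lemma row_len_inj la mu : (forall i, (i < n)%N -> row_len la i = row_len mu i) -> la = mu.
Proof.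
move=> e; apply/val_inj/eq_from_tnth => i.
by have := e i (ltn_ord i); rewrite !row_lenE.
Qed.

Lemma row_len_subP la mu :
  reflect (forall i, row_len la i <= row_len mu i)%N (part_sub la mu).
Proof.
apply: (iffP (part_subP _ _)) => le i; last by have := le i; rewrite !row_lenE.
have [lt | ge] := ltnP i n; last by rewrite (row_len_out la ge).
by have := le (Ordinal lt); rewrite -!row_lenE.
Qed.

Lemma part_sub_refl la : part_sub la la.
Proof. by apply/part_subP. Qed.

Lemma part_sub_trans : transitive (@part_sub n).
Proof.
move=> mu la nu /part_subP le1 /part_subP le2; apply/part_subP => i.
exact: leq_trans (le1 i) (le2 i).
Qed.

Lemma mem_skew la mu (i : 'I_n) j :
  ((i, j) \in Defs.skew la mu) = (row_len mu i <= j < row_len la i)%N.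
Proof. by rewrite mem_filter !mem_diagram -leqNgt !row_lenE. Qed.

Lemma skew_uniq la mu : uniq (Defs.skew la mu).
Proof. exact/filter_uniq/diagram_uniq. Qed.

Lemma uniq_map_inj (T S : eqType) (f : T -> S) (s : seq T) :
  uniq (map f s) -> {in s &, injective f}.
Proof.
elim: s => //= x s IHs /andP [fxNs /IHs inj] y z.
rewrite !inE => /predU1P [-> | ys] /predU1P [-> | zs] // e; last exact: inj.
  by rewrite e map_f in fxNs.
by rewrite -e map_f in fxNs.
Qed.

(** If row i grows while row i.-1 of mu has the same length, row i.-1 must grow too, in the same
    column. Conversely, two added boxes in one column would contradict the condition on the lower
    one. *)
Lemma rook_step mu la :
  rook mu la = [forall i : 'I_n, step (pos mu) i (pos la i)].
Proof.
have stepE (i : 'I_n) : step (pos mu) i (pos la i) =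
    (row_len la i == row_len mu i) || (row_len la i == (row_len mu i).+1) &&
    ((i == 0 :> nat) || (row_len mu i < row_len mu i.-1)%N).
  rewrite /step /addable /pos; have := ltn_ord i.
  by case: (nat_of_ord i) => [|k] /=; lia.
under eq_forallb do rewrite stepE.
apply/and3P/forallP => [[/row_len_subP sub /uniq_map_inj inj1 /uniq_map_inj inj2] i | st].
  have le1 : (row_len la i <= (row_len mu i).+1)%N.
    rewrite leqNgt; apply/negP => lt.
    have := inj1 (i, row_len mu i) (i, (row_len mu i).+1).
    rewrite !mem_skew leqnn (ltnW lt) lt leqnSn => /(_ isT isT erefl) [].
    by move=> /eqP; rewrite ltn_eqF.
  have [//|ne] := eqVneq (row_len la i) (row_len mu i).
  have -> : row_len la i = (row_len mu i).+1 by have := sub i; move: ne le1; lia.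
  rewrite eqxx /=; case: posnP => //= i_gt0; rewrite ltnNge; apply/negP => le.
  have lt1 : (i.-1 < n)%N by apply: leq_ltn_trans (leq_pred _) (ltn_ord i).
  have d1 := row_len_decr mu i.-1; have d2 := row_len_decr la i.-1.
  have := sub i; have := sub i.-1; rewrite prednK // in d1 d2.
  move=> s1 s2.
  have := inj2 (i, row_len mu i) (Ordinal lt1, row_len mu i).
  rewrite !mem_skew /= leqnn.
  have -> : (row_len mu i < row_len la i)%N by move: ne; lia.
  have -> : (row_len mu i.-1 <= row_len mu i < row_len la i.-1)%N by move: ne; lia.
  by move=> /(_ isT isT erefl) [] /(congr1 val) /=; lia.
have mu_la i : (row_len mu i <= row_len la i)%N.
  have [lt | ge] := ltnP i n; last by rewrite row_len_out.
  by have := st (Ordinal lt) => /=; lia.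
have inj i j : (i, j) \in Defs.skew la mu -> j = row_len mu i /\
    ((0 < i)%N -> (row_len mu i < row_len mu i.-1)%N).
  by rewrite mem_skew; have := st i; lia.
have decr i j : (i <= j)%N -> (row_len mu j <= row_len mu i)%N.
  elim: j => [|j IHj]; first by rewrite leqn0 => /eqP ->.
  rewrite leq_eqVlt => /orP [/eqP -> // | /IHj]; apply: leq_trans.
  exact: row_len_decr.
split; first exact/row_len_subP.
  rewrite map_inj_in_uniq ?skew_uniq // => [[i j] [i' j']] /inj [-> _] /inj [-> _] /= ->.
  by [].
rewrite map_inj_in_uniq ?skew_uniq // => [[i j] [i' j']] /inj [-> h] /inj [-> h'] /= e.
suff: i = i' by move->.
apply: val_inj; case: (ltngtP i i') => // lt /=.
  have := h' (leq_ltn_trans (leq0n _) lt); rewrite -e.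
  by have := decr i i'.-1; lia.
have := h (leq_ltn_trans (leq0n _) lt); rewrite e.
by have := decr i' i.-1; lia.
Qed.

Lemma mem_rook_cons mu la : (la \in mu :: rook_above mu) = rook mu la.
Proof.
rewrite inE mem_rook_above /rooks eq_sym; have [-> | _] := eqVneq mu la.
  by rewrite rook_step; apply/esym/forallP => i; rewrite /step eqxx.
by rewrite andbT.
Qed.

Lemma size_skew mu la : part_sub mu la ->
  (size (diagram mu) + skew_size la mu)%N = size (diagram la).
Proof.
move=> /allP sub; rewrite -size_cat; apply/perm_size/uniq_perm; rewrite ?diagram_uniq //.
  rewrite cat_uniq diagram_uniq skew_uniq andbT /=; apply/hasPn => x.
  by rewrite mem_filter => /andP [].
move=> x; rewrite mem_cat mem_filter.
by case: (boolP (x \in diagram mu)) => //= /sub ->.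
Qed.

Lemma part_of_positions (v : nat -> nat) :
  strict n v -> exists la, forall i, (i < n)%N -> pos la i = v i.
Proof.
move=> v_str.
have nthE i : (i < n)%N -> nth 0%N [tuple (v i - (n - i))%N | i < n] i = (v i - (n - i))%N.
  by move=> lt; rewrite -[i in LHS]/(nat_of_ord (Ordinal lt)) -tnth_nth tnth_mktuple.
have srt : sorted geq [tuple (v i - (n - i))%N | i < n].
  apply/(sortedP 0%N) => i; rewrite size_tuple => lt; rewrite !nthE ?(ltnW lt) //.
  by have := v_str.2 i lt; rewrite /geq /=; lia.
exists (Part srt) => i lt; have := strict_ge v_str lt.
rewrite /pos /row_len nthE //; lia.
Qed.

End Positions.

(** * Values at the dual points: triangularity and the Pieri rule *)

Section DualPoints.

Variables (K : fieldType) (n : nat) (beta : K) (a : nat -> K).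
Hypothesis beta_neq0 : beta != 0.
Hypothesis a_neq0 : forall j, (0 < j)%N -> 1 + beta * a j != 0.
Hypothesis a_inj : forall i j, (0 < i)%N -> (0 < j)%N -> a i = a j -> i = j.

Implicit Types (la mu nu ka : part n).

Let b := bshift beta a.

(* Reversing a_ka makes the vanishing visible on tableaux, so the symmetry of
   the Grothendieck polynomials is never needed; P does not see the reversal,
   being symmetric. *)
Definition rev_apoint ka (i : 'I_n) : K := apoint beta a ka (rev_ord i).

Let u ka := ushift beta (rev_apoint ka).

Definition dual_value la ka : K := (grothendieck beta a la).@[rev_apoint ka].

Lemma dual_valueE M la ka : (forall i, (i < n)%N -> (pos la i < M)%N) ->
  beta ^+ size (diagram la) * dual_value la ka = branch_sum b (u ka) M n (pos la).
Proof.
move=> lt_M; rewrite /dual_value (@meval_grothendieck _ _ _ _ M) => [|i]; last first.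
  by have := lt_M i (ltn_ord i); rewrite /pos row_lenE; lia.
rewrite -(@tableau_sum_branch n M) //; last exact: pos_strict.
apply: eq_bigl => T; apply: eq_forallb => i; apply: eq_forallb => j.
by rewrite shape_of_pos.
Qed.

Lemma exists_bound la mu : exists M, forall i, (i < n)%N ->
  ((pos la i).+1 < M)%N /\ ((pos mu i).+1 < M)%N.
Proof.
exists (\sum_(i < n) (pos la i + pos mu i)).+2%N => i lt.
by rewrite (bigD1 (Ordinal lt)) //=; lia.
Qed.

(** The positions of ka decrease with the row, so after the reversal they increase with the
    variable, as [dual_point] requires. *)
Lemma dual_rev_apoint ka : dual_point b (u ka) (fun r => pos ka (n.-1 - r)) n.
Proof.
move=> r lt_rn; have str := pos_strict ka; have lt : (n.-1 - r < n)%N by lia.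
split; first exact: str.1.
  rewrite /u /ushift insubT /= /rev_apoint /apoint one_beta_ominus; last first.
    by apply: a_neq0; rewrite part_index_gt0.
  rewrite /b /bshift.
  have -> : pos ka (n.-1 - r) = (n - rev_ord (Ordinal lt_rn) + ka (rev_ord (Ordinal lt_rn)))%N.
    by rewrite -posE /=; congr pos; lia.
  by rewrite mulVf // a_neq0 // part_index_gt0.
move=> r_gt0; have -> : (n.-1 - r.-1 = (n.-1 - r).+1)%N by lia.
by apply: str.2; lia.
Qed.

Lemma dual_value_vanish la ka : dual_value la ka != 0 -> part_sub la ka.
Proof.
move=> nz; have [M lt_M] := exists_bound la la.
have : branch_sum b (u ka) M n (pos la) != 0.
  by rewrite -dual_valueE ?mulf_neq0 ?expf_neq0 // => i /lt_M [/ltnW].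
move=> /(branch_sum_vanish (pos_strict la) (dual_rev_apoint ka)) le.
apply/part_subP => i; have := le i (ltn_ord i).
have -> : (n.-1 - (n.-1 - i) = i)%N by have := ltn_ord i; lia.
by rewrite /pos !row_lenE leq_add2r.
Qed.

Lemma dual_value_diag ka : dual_value ka ka != 0.
Proof.
have [M lt_M] := exists_bound ka ka.
suff : branch_sum b (u ka) M n (pos ka) != 0.
  by rewrite -dual_valueE ?mulf_eq0 ?negb_or => [/andP [] //| i /lt_M [/ltnW]].
have b_inj i j : (0 < i)%N -> (0 < j)%N -> b i = b j -> i = j.
  by move=> i_gt0 j_gt0 /addrI /(mulfI beta_neq0); apply: a_inj.
apply: (branch_sum_diag b_inj (pos_strict ka) (dual_rev_apoint ka)) => i lt.
  by have [/ltnW] := lt_M i lt.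
by congr pos; lia.
Qed.

(** Functions passing the [step] test are strict, hence are the positions of a partition by
    [part_of_positions], and [rook_step] identifies which ones. *)
Lemma sum_steps (M : nat) mu (f : (nat -> nat) -> K) :
  (forall l l', (forall i, (i < n)%N -> l i = l' i) -> f l = f l') ->
  (forall i, (i < n)%N -> ((pos mu i).+1 < M)%N) ->
  \sum_(v : {ffun 'I_n -> 'I_M}) (\prod_(i < n) (step (pos mu) i (v i))%:R) * f (ext v) =
  \sum_(la <- mu :: rook_above mu) f (pos la).
Proof.
move=> f_ext lt_M.
have pos_lt la i (rk : rook mu la) (lt : (i < n)%N) : (pos la i < M)%N.
  have := rk; rewrite rook_step => /forallP /(_ (Ordinal lt)) /=.
  by rewrite /step; have := lt_M i lt; lia.
pose F la : {ffun 'I_n -> 'I_M} :=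
  [ffun i : 'I_n => insubd (Ordinal (leq_ltn_trans (leq0n _) (lt_M i (ltn_ord i)))) (pos la i)].
have extF la i : rook mu la -> (i < n)%N -> ext (F la) i = pos la i.
  move=> rk lt; rewrite (@extE _ _ (F la) (Ordinal lt)) // ffunE val_insubd.
  by rewrite pos_lt.
transitivity (\sum_(v <- map F (mu :: rook_above mu)) f (ext v)); last first.
  rewrite big_map !big_seq; apply: eq_bigr => la; rewrite mem_rook_cons => rk.
  by apply: f_ext => i; apply: extF.
under eq_bigr do rewrite prod_natr_bool.
transitivity (\sum_(v : {ffun 'I_n -> 'I_M} | [forall i : 'I_n, step (pos mu) i (v i)]) f (ext v)).
  by rewrite [RHS]big_mkcond; apply: eq_bigr => v _; case: ifP; rewrite ?mul1r ?mul0r.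
rewrite -big_filter; apply/perm_big/uniq_perm; first exact/filter_uniq/index_enum_uniq.
  rewrite map_inj_in_uniq /= => [|la la'].
    by rewrite rook_above_uniq mem_rook_above /rooks eqxx andbF.
  rewrite !mem_rook_cons => rk rk' /(congr1 (@ext M n)) e; apply: row_len_inj => i lt.
  have := extF _ _ rk lt; rewrite e (extF _ _ rk' lt) /pos => /eqP.
  by rewrite eqn_add2r => /eqP.
move=> v; rewrite mem_filter mem_index_enum andbT; apply/idP/mapP => [st | [la]].
  have {}st i (lt : (i < n)%N) : step (pos mu) i (ext v i).
    by move/forallP: st => /(_ (Ordinal lt)); rewrite -(@extE _ _ v (Ordinal lt) i).
  have [mu_gt0 mu_decr] := pos_strict mu.
  have v_str : strict n (ext v).
    split=> i lt; first by have := st i lt; have := mu_gt0 i lt; rewrite /step; lia.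
    have := st i (ltnW lt); have := st i.+1 lt; have := mu_decr i lt.
    by rewrite /step /addable /=; lia.
  have [la la_v] := part_of_positions v_str.
  have rk : rook mu la by rewrite rook_step; apply/forallP => i; rewrite la_v ?st.
  exists la; rewrite ?mem_rook_cons //; apply/ffunP => i; apply: val_inj.
  by rewrite /= -!ext_ord extF // la_v.
rewrite mem_rook_cons => rk ->; have := rk; rewrite rook_step => /forallP st.
by apply/forallP => i; rewrite -ext_ord extF.
Qed.

(** This is [pieri] at a dual point; cancelling beta ^ |mu| from the weights beta ^ |la| leaves the
    exponent |la/mu|. *)
Lemma dual_value_pieri mu ka :
  Pi beta (apoint beta a ka) * dual_value mu ka =
  Pi beta (apoint beta a mu) *
    \sum_(la <- mu :: rook_above mu) beta ^+ skew_size la mu * dual_value la ka.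
Proof.
have [M lt_M] := exists_bound mu mu.
have lt_M1 i (lt : (i < n)%N) := (lt_M i lt).1.
have b_neq0 j : (0 < j)%N -> b j != 0 by apply: a_neq0.
have := pieri (u ka) b_neq0 (pos_strict mu) lt_M1.
rewrite sum_steps //; last exact: eq_branch_sum.
rewrite -dual_valueE => [|i /lt_M1 /ltnW //].
have -> : \prod_(r < n) u ka r = Pi beta (apoint beta a ka).
  rewrite [RHS](reindex_inj rev_ord_inj); apply: eq_bigr => r _.
  by rewrite /u /ushift valK.
have -> : (\prod_(i < n) b (pos mu i))^-1 = Pi beta (apoint beta a mu).
  by rewrite Pi_apointE //; congr _^-1; apply: eq_bigr => i _; rewrite posE.
move=> e; apply: (mulfI (expf_neq0 (size (diagram mu)) beta_neq0)).
rewrite mulrCA e mulrCA; congr (_ * _); rewrite mulr_sumr !big_seq.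
apply: eq_bigr => la; rewrite mem_rook_cons => rk; have /and3P [sub _ _] := rk.
rewrite mulrA -exprD size_skew // (@dual_valueE M) // => i lt.
have := rk; rewrite rook_step => /forallP /(_ (Ordinal lt)) /=.
by rewrite /step; have := lt_M1 i lt; lia.
Qed.

End DualPoints.

(** * The recurrence and its solution *)

Section DividedDifference.

Variable K : fieldType.
Implicit Types x y : nat -> K.

Definition divdiff x y m : K :=
  \sum_(0 <= k < m) y k * \prod_(0 <= i < m | i != k) (x k - x i)^-1.

Lemma eq_divdiff x y x' y' m :
  (forall i, (i < m)%N -> x i = x' i) -> (forall i, (i < m)%N -> y i = y' i) ->
  divdiff x y m = divdiff x' y' m.
Proof.
move=> ex ey; apply: eq_big_nat => k /andP [_ lt_k]; rewrite ey //; congr (_ * _).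
rewrite big_nat_cond [RHS]big_nat_cond; apply: eq_bigr => i /andP [/andP [_ lt_i] _].
by rewrite !ex.
Qed.

(** Writing x l - x 0 as (x k - x 0) - (x k - x l) splits each inner term into partial fractions,
    one for each shorter difference; each end term belongs to only one of them. *)
Lemma divdiff_rec x y l : (0 < l)%N ->
  (forall i j, (i <= l)%N -> (j <= l)%N -> x i = x j -> i = j) ->
  (x l - x 0%N) * divdiff x y l.+1 =
  divdiff (x \o succn) (y \o succn) l - divdiff x y l.
Proof.
case: l => // l _ x_inj.
have nz i j : (i <= l.+1)%N -> (j <= l.+1)%N -> i != j -> x i - x j != 0.
  by move=> li lj; apply: contraNneq => /subr0_eq /(x_inj _ _ li lj) ->.
pose mid k := \prod_(0 <= i < l | i.+1 != k) (x k - x i.+1)^-1.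
have prodL k : \prod_(0 <= i < l.+1 | i != k) (x k - x i)^-1 =
    (if 0%N == k then 1 else (x k - x 0%N)^-1) * mid k.
  by rewrite big_mkcond big_nat_recl //= -big_mkcond; case: eqP.
have prodR k : \prod_(0 <= i < l.+1 | i != k) (x k.+1 - x i.+1)^-1 =
    mid k.+1 * (if l == k then 1 else (x k.+1 - x l.+1)^-1).
  by rewrite big_mkcond big_nat_recr //= -big_mkcond; case: (l =P k).
have prodF k : \prod_(0 <= i < l.+2 | i != k) (x k - x i)^-1 =
    (if 0%N == k then 1 else (x k - x 0%N)^-1) * mid k *
    (if l.+1 == k then 1 else (x k - x l.+1)^-1).
  rewrite big_mkcond big_nat_recl //= big_nat_recr //= -big_mkcond mulrA.
  by case: eqP; case: (l.+1 =P k).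
rewrite /divdiff big_nat_recl // big_nat_recr //= [X in _ = X - _]big_nat_recr //=.
rewrite [X in _ = _ - X]big_nat_recl //= !mulrDr.
rewrite !prodF prodL // prodR /= !eqxx !mulr1 !mul1r.
have e0 : (x l.+1 - x 0%N) * (y 0%N * (mid 0%N * (x 0%N - x l.+1)^-1)) = - (y 0%N * mid 0%N).
  rewrite -[x l.+1 - x 0%N]opprB mulNr; congr (- _).
  by rewrite mulrC -!mulrA mulVf ?mulr1 // nz.
have e1 : (x l.+1 - x 0%N) * (y l.+1 * ((x l.+1 - x 0%N)^-1 * mid l.+1)) = y l.+1 * mid l.+1.
  by rewrite mulrCA mulVKf // nz.
rewrite e0 e1 mulr_sumr.
have -> : \sum_(0 <= i < l) (x l.+1 - x 0%N) *
    (y i.+1 * \prod_(0 <= i0 < l.+2 | i0 != i.+1) (x i.+1 - x i0)^-1) =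
    \sum_(0 <= i < l) y i.+1 * \prod_(0 <= i0 < l.+1 | i0 != i) (x i.+1 - x i0.+1)^-1
    - \sum_(0 <= i < l) y i.+1 * \prod_(0 <= i0 < l.+1 | i0 != i.+1) (x i.+1 - x i0)^-1.
  rewrite -sumrB; apply: eq_big_nat => i /andP [_ lt_i].
  rewrite prodF prodR prodL //= eqSS !(gtn_eqF lt_i).
  have n1 : x i.+1 - x 0%N != 0 by apply: nz => //; lia.
  have n2 : x i.+1 - x l.+1 != 0 by apply: nz => //; lia.
  by field; rewrite n1 n2.
by ring.
Qed.

End DividedDifference.

(** * The sum over chains as the unique solution of the recurrence *)

Section Chains.

Variables (K : fieldType) (n : nat) (beta : K) (p f : part n -> K).
Hypothesis p_inj : injective p.
Implicit Types (la mu nu eta : part n) (R : seq (part n)).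

Definition node mu R k : part n := nth mu (mu :: R) k.

(* The inner sum of the formula is the divided difference of f at the nodes p. *)
Definition chain_term mu R : K :=
  (\prod_(0 <= i < size R) p (node mu R i)) *
  divdiff (p \o node mu R) (f \o node mu R) (size R).+1.

Definition chain_sum mu nu : K := \sum_(R <- chains mu nu) chain_term mu R.

Lemma path_rooks_sub mu R : path (@rooks n) mu R -> part_sub mu (last mu R).
Proof.
elim: R mu => [|la R IHR] mu /=; first by rewrite part_sub_refl.
case/andP => /andP [/and3P [sub _ _] _] /IHR; exact: part_sub_trans sub.
Qed.

(** Sizes increase strictly along a chain. With p injective, the nodes of the divided difference are
    therefore distinct. *)
Lemma path_rooks_uniq mu R : path (@rooks n) mu R -> uniq (mu :: R).
Proof.
pose lt_size (la nu : part n) := (size (diagram la) < size (diagram nu))%N.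
move=> pR; apply: (@sorted_uniq _ lt_size) => [la mu' nu|la|].
- exact: ltn_trans.
- exact: ltnn.
- by apply: sub_path pR => la nu; apply: rooks_size.
Qed.

(** [R2] and [R1] are the chain without its first and its last node. The prefactor omits the last
    node, so dropping mu releases p mu, and dropping nu releases p at the node before it. *)
Lemma chain_term_rec mu la nu R1 R2 : uniq (mu :: la :: R2) -> la :: R2 = rcons R1 nu ->
  (p nu - p mu) * chain_term mu (la :: R2) =
  p mu * chain_term la R2 - p (last mu R1) * chain_term mu R1.
Proof.
move=> uR eR; have sR : size R1 = size R2.
  by apply/succn_inj; rewrite -(size_rcons R1 nu) -eR.
have nodeS i : (i < (size R2).+1)%N -> node mu (la :: R2) i.+1 = node la R2 i.
  by move=> lt; apply: set_nth_default.
have nodeR i : (i < (size R2).+1)%N -> node mu (la :: R2) i = node mu R1 i.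
  by move=> lt; rewrite /node eR -rcons_cons nth_rcons /= sR lt.
have nodel : node mu (la :: R2) (size R2).+1 = nu.
  by rewrite /node eR -rcons_cons nth_rcons /= sR ltnn eqxx.
have node_last : node mu R1 (size R1) = last mu R1 by rewrite /node nth_last.
rewrite /chain_term mulrCA /=.
have {1}-> : nu = node mu (la :: R2) (size R2).+1 by rewrite nodel.
have x_inj i j : (i <= (size R2).+1)%N -> (j <= (size R2).+1)%N ->
    (p \o node mu (la :: R2)) i = (p \o node mu (la :: R2)) j -> i = j.
  by move=> li lj /p_inj e; apply/eqP; rewrite -(nth_uniq mu _ _ uR) //; apply/eqP.
rewrite [X in _ * X](divdiff_rec _ (ltn0Sn _) x_inj).
rewrite mulrBr; congr (_ - _).
  rewrite big_nat_recl //= -mulrA; congr (_ * (_ * _)).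
    by apply: eq_big_nat => i /andP [_ lt]; rewrite nodeS // ltnW.
  by apply: eq_divdiff => i lt; rewrite /= nodeS.
have -> : \prod_(0 <= i < (size R2).+1) p (node mu (la :: R2) i) =
    p (last mu R1) * \prod_(0 <= i < size R1) p (node mu R1 i).
  rewrite big_nat_recr //= (nodeR _ (ltnSn _)) -[X in node mu R1 X]sR node_last mulrC -sR.
  by congr (_ * _); apply: eq_big_nat => i /andP [_ lt]; rewrite nodeR // -sR ltnW.
rewrite -mulrA; congr (_ * (_ * _)).
by rewrite sR; apply: eq_divdiff => i lt; rewrite /= nodeR.
Qed.

Lemma chains_cons mu nu : mu != nu ->
  perm_eq (chains mu nu) [seq la :: R | la <- rook_above mu, R <- chains la nu].
Proof.
move=> neq; apply: uniq_perm; first exact: chains_uniq.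
  apply: allpairs_uniq_dep => [||[x R] [y R'] _ _ [-> ->] //]; first exact: rook_above_uniq.
  by move=> la _; apply: chains_uniq.
move=> R; rewrite mem_chains; apply/idP/allpairsPdep => [|[la [R' [la_mu R'_la ->]]]].
  case: R => [|la R] /=; first by rewrite (negbTE neq).
  case/andP => /andP [mu_la pR] lR; exists la, R.
  by rewrite mem_rook_above mem_chains mu_la pR lR.
by rewrite /= -mem_rook_above la_mu; move: R'_la; rewrite mem_chains.
Qed.

Lemma chains_rcons mu nu : mu != nu ->
  perm_eq (chains mu nu) [seq rcons R nu | eta <- rook_below nu, R <- chains mu eta].
Proof.
move=> neq; apply: uniq_perm; first exact: chains_uniq.
  apply: allpairs_uniq_dep => [|eta _|[x R] [y R'] ]; first exact: rook_below_uniq.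
    exact: chains_uniq.
  case/allpairsPdep => [x1 [R1 [_ R1in [-> ->]]]] /allpairsPdep [x2 [R2 [_ R2in [-> ->]]]] /=.
  move=> /rcons_inj [e]; move: R1in R2in; rewrite !mem_chains e.
  by move=> /andP [_ /eqP ->] /andP [_ /eqP ->].
move=> R; rewrite mem_chains; apply/idP/allpairsPdep => [|[eta [R' [eta_nu R'_eta ->]]]].
  case: (lastP R) => [|R' la] /=; first by rewrite (negbTE neq).
  rewrite rcons_path last_rcons => /andP [/andP [pR R_la] /eqP e]; exists (last mu R'), R'.
  by rewrite mem_rook_below mem_chains pR eqxx -e R_la.
rewrite rcons_path last_rcons eqxx andbT; move: R'_eta; rewrite mem_chains.
by case/andP => -> /eqP ->; rewrite -mem_rook_below.
Qed.

(** Sum [chain_term_rec] over all chains, grouping one part by the first step and the other by the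
    last. *)
Lemma chain_sum_rec mu nu : mu != nu ->
  (p nu - p mu) * chain_sum mu nu =
  \sum_(la <- rook_above mu) p mu * chain_sum la nu
  - \sum_(eta <- rook_below nu) p eta * chain_sum mu eta.
Proof.
move=> neq; pose init R := take (size R).-1 R.
transitivity (\sum_(R <- chains mu nu)
  (p mu * chain_term (head mu R) (behead R)
   - p (last mu (init R)) * chain_term mu (init R))).
  rewrite mulr_sumr !big_seq; apply: eq_bigr => R; rewrite mem_chains.
  case/andP => pR /eqP; case: R pR => [_ e | la R pR lR]; first by rewrite -e eqxx in neq.
  have eR : la :: R = rcons (init (la :: R)) nu.
    by rewrite -lR [last mu _]/= lastI /init size_rcons /= -cats1 take_size_cat ?cats1 //.
  by rewrite (chain_term_rec (path_rooks_uniq pR) eR).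
rewrite sumrB; congr (_ - _).
  rewrite (perm_big _ (chains_cons neq)) /= big_allpairs_dep /=.
  by apply: eq_bigr => la _; rewrite mulr_sumr.
rewrite (perm_big _ (chains_rcons neq)) /= big_allpairs_dep /=.
apply: eq_bigr => eta _; rewrite mulr_sumr !big_seq; apply: eq_bigr => R.
rewrite mem_chains => /andP [_ /eqP e].
by rewrite /init size_rcons /= -cats1 take_size_cat // e.
Qed.

Lemma chain_sum_out mu nu : ~~ part_sub mu nu -> chain_sum mu nu = 0.
Proof.
move=> nsub; rewrite /chain_sum big_seq big1 // => R; rewrite mem_chains.
by case/andP => /path_rooks_sub sub /eqP e; rewrite e in sub; rewrite sub in nsub.
Qed.

Lemma chain_sum_diag la : chain_sum la la = f la.
Proof.
have perm_nil : perm_eq (chains la la) [:: [::]].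
  apply: uniq_perm; rewrite ?chains_uniq // => R; rewrite mem_chains inE.
  case: R => [|mu R] /=; first by rewrite eqxx.
  apply/negbTE/negP => /andP [pR /eqP e].
  have := @path_rooks_uniq la (mu :: R) pR; rewrite /= -[X in X \notin _]e.
  by rewrite mem_last.
rewrite /chain_sum (perm_big _ perm_nil) big_seq1 /chain_term big_geq // mul1r.
by rewrite /divdiff big_nat1 big_mkcond big_nat1 /= mulr1.
Qed.

Definition chain_solution mu nu : K := beta ^+ skew_size nu mu * chain_sum mu nu.

Definition solves_recurrence (g : part n -> part n -> K) : Prop :=
  forall mu nu, mu != nu ->
    g mu nu = (p nu - p mu)^-1 *
      (\sum_(la <- rook_above mu) p mu * beta ^+ skew_size la mu * g la nu
       - \sum_(eta <- rook_below nu) p eta * beta ^+ skew_size nu eta * g mu eta).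

Definition solves_boundary (g : part n -> part n -> K) : Prop :=
  (forall mu nu, ~~ part_sub mu nu -> g mu nu = 0) /\ (forall la, g la la = f la).

Lemma skew_sizeD mu la nu : part_sub mu la -> part_sub la nu ->
  (skew_size la mu + skew_size nu la)%N = skew_size nu mu.
Proof.
move=> s1 s2; have s3 := part_sub_trans s1 s2.
have := size_skew s1; have := size_skew s2; have := size_skew s3.
by lia.
Qed.

Lemma rooks_sub mu nu : rooks mu nu -> part_sub mu nu.
Proof. by case/andP => /and3P []. Qed.

Lemma chain_solution_recurrence : solves_recurrence chain_solution.
Proof.
move=> mu nu neq; have nz : p nu - p mu != 0.
  by apply: contraNneq neq => /subr0_eq /p_inj ->.
apply: (mulfI nz); rewrite mulVKf // /chain_solution mulrCA chain_sum_rec // mulrBr.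
rewrite !mulr_sumr; congr (_ - _); rewrite !big_seq; apply: eq_bigr => la.
  rewrite mem_rook_above => /rooks_sub s1.
  have [s2|/chain_sum_out ->] := boolP (part_sub la nu); last by rewrite !mulr0.
  by rewrite -(skew_sizeD s1 s2) exprD; ring.
rewrite mem_rook_below => /rooks_sub s2.
have [s1|/chain_sum_out ->] := boolP (part_sub mu la); last by rewrite !mulr0.
by rewrite -(skew_sizeD s1 s2) exprD; ring.
Qed.

Lemma skew_size_refl la : skew_size la la = 0%N.
Proof. by have := size_skew (part_sub_refl la); lia. Qed.

Lemma chain_solution_boundary : solves_boundary chain_solution.
Proof.
split=> [mu nu /chain_sum_out | la]; first by rewrite /chain_solution => ->; rewrite mulr0.
by rewrite /chain_solution skew_size_refl mul1r chain_sum_diag.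
Qed.

Lemma recurrence_unique g h : solves_recurrence g -> solves_boundary g ->
  solves_recurrence h -> solves_boundary h -> forall mu nu, g mu nu = h mu nu.
Proof.
move=> rg [g0 gf] rh [h0 hf].
(* The difference is truncated. It still drops at each use of the hypothesis, since containment is
   checked first; without containment both values are 0. *)
suff: forall m mu nu, (size (diagram nu) - size (diagram mu) < m)%N -> g mu nu = h mu nu.
  by move=> h_all mu nu; apply: h_all (ltnSn _).
elim=> // m IHm mu nu lt_m; have [-> | neq] := eqVneq mu nu; first by rewrite gf hf.
rewrite rg // rh //; congr (_ * (_ - _)); rewrite !big_seq; apply: eq_bigr => la.
  rewrite mem_rook_above => r; congr (_ * _).
  have [s|ns] := boolP (part_sub la nu); last by rewrite g0 ?h0.
  by apply: IHm; have := rooks_size r; have := size_skew s; lia.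
rewrite mem_rook_below => r; congr (_ * _).
have [s|ns] := boolP (part_sub mu la); last by rewrite g0 ?h0.
by apply: IHm; have := rooks_size r; have := size_skew s; lia.
Qed.

End Chains.

(** * From an expansion to the boundary conditions and the recurrence *)

Section Expansion.

Variables (K : fieldType) (n : nat) (beta : K) (p f : part n -> K).
Variable V : part n -> part n -> K.
Implicit Types (la mu nu eta ka : part n) (s t : seq (part n)).

Hypothesis p_inj : injective p.
Hypothesis V_sub : forall la ka, V la ka != 0 -> part_sub la ka.
Hypothesis V_diag : forall ka, V ka ka != 0.
Hypothesis V_pieri : forall mu ka,
  p ka * V mu ka = p mu * \sum_(la <- mu :: rook_above mu) beta ^+ skew_size la mu * V la ka.

Lemma sub_size la ka : part_sub la ka -> la != ka ->
  (size (diagram la) < size (diagram ka))%N.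
Proof.
move=> sub ne; have := size_skew sub; case: (posnP (skew_size ka la)) => [e _ | ]; last lia.
case/eqP: ne; apply: row_len_inj => i lt; have /row_len_subP le := sub.
apply/eqP; rewrite eqn_leq le leqNgt; apply/negP => lt_i.
have : (Ordinal lt, row_len la i) \in Defs.skew ka la by rewrite mem_skew leqnn lt_i.
by move/eqP: e; rewrite size_eq0 => /eqP ->.
Qed.

Lemma eq_big_support s t (F : part n -> K) : uniq s -> uniq t ->
  (forall x, x \notin s -> x \in t -> F x = 0) ->
  (forall x, x \notin t -> x \in s -> F x = 0) ->
  \sum_(x <- s) F x = \sum_(x <- t) F x.
Proof.
move=> us ut s0 t0; rewrite (bigID (fun x => x \in t)) [RHS](bigID (fun x => x \in s)) /=.
rewrite [X in _ + X]big_seq_cond [X in _ + X]big1 => [|x /andP [xs xt]]; last exact: t0.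
rewrite [X in _ = _ + X]big_seq_cond [X in _ = _ + X]big1 => [|x /andP [xt xs]]; last first.
  exact: s0.
rewrite !addr0 -big_filter -[RHS]big_filter; apply/perm_big/uniq_perm; rewrite ?filter_uniq // => x.
by rewrite !mem_filter andbC.
Qed.

(** At ka only shapes contained in ka have non-zero value, so under these hypotheses ka alone
    contributes. *)
Lemma eval_leading s (c : part n -> K) ka : uniq s ->
  (forall nu, nu \notin s -> c nu = 0) ->
  (forall nu, nu != ka -> part_sub nu ka -> c nu = 0) ->
  \sum_(nu <- s) c nu * V nu ka = c ka * V ka ka.
Proof.
move=> us out low; transitivity (\sum_(nu <- [:: ka]) c nu * V nu ka); last by rewrite big_seq1.
apply: eq_big_support => // [x /out -> _|x]; first by rewrite mul0r.
rewrite inE => ne _; have [-> | /V_sub sub] := eqVneq (V x ka) 0; first by rewrite mulr0.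
by rewrite low ?mul0r.
Qed.

Lemma values_independent s (c : part n -> K) : uniq s ->
  (forall nu, nu \notin s -> c nu = 0) ->
  (forall ka, \sum_(nu <- s) c nu * V nu ka = 0) -> forall nu, c nu = 0.
Proof.
move=> us out zero.
suff: forall m nu, (size (diagram nu) < m)%N -> c nu = 0.
  by move=> h nu; apply: h (ltnSn _).
elim=> // m IHm nu lt; have := zero nu; rewrite eval_leading // => [/eqP|eta ne sub].
  by rewrite mulf_eq0 (negbTE (V_diag _)) orbF => /eqP.
by apply: IHm; have := sub_size sub ne; lia.
Qed.

Variable g : part n -> part n -> K.
Hypothesis g_expansion : forall mu, exists s : seq (part n),
  [/\ uniq s, forall nu, nu \notin s -> g mu nu = 0
    & forall ka, f ka * V mu ka = \sum_(nu <- s) g mu nu * V nu ka].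

Lemma expansion_on mu t : uniq t -> (forall nu, nu \notin t -> g mu nu = 0) ->
  forall ka, f ka * V mu ka = \sum_(nu <- t) g mu nu * V nu ka.
Proof.
move=> ut out ka; have [s [us out_s ->]] := g_expansion mu.
by apply: eq_big_support => // x; [move/out_s -> | move/out ->]; rewrite mul0r.
Qed.

(** Evaluate at nu: if mu is not contained in nu the left side vanishes, and by induction on |nu|
    only the coefficient at nu is left. Evaluating at la then isolates g la la. *)
Lemma expansion_boundary : solves_boundary f g.
Proof.
have lower mu nu : ~~ part_sub mu nu -> g mu nu = 0.
  suff: forall m nu, (size (diagram nu) < m)%N -> ~~ part_sub mu nu -> g mu nu = 0.
    by move=> h; apply: h (ltnSn _).
  elim=> // m IHm {}nu lt nsub; have [s [us out e]] := g_expansion mu.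
  have := e nu; have [-> | /V_sub sub] := eqVneq (V mu nu) 0; last by rewrite sub in nsub.
  rewrite mulr0 eval_leading // => [/esym/eqP|eta ne sub].
    by rewrite mulf_eq0 (negbTE (V_diag _)) orbF => /eqP.
  apply: IHm; first by have := sub_size sub ne; lia.
  by apply: contra nsub => sub'; apply: part_sub_trans sub' sub.
split=> // la; have [s [us out e]] := g_expansion la.
apply/esym/(mulIf (V_diag la)); rewrite e eval_leading // => nu ne sub.
apply: lower; apply/negP => sub'.
by have := sub_size sub ne; have := size_skew sub'; lia.
Qed.

Lemma common_support s : exists t, uniq t /\
  forall mu, mu \in s -> forall nu, nu \notin t -> g mu nu = 0.
Proof.
elim: s => [|mu s [t [ut out]]]; first by exists [::].
have [t' [_ out' _]] := g_expansion mu; exists (undup (t ++ t')); split.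
  exact: undup_uniq.
move=> la; rewrite inE => /predU1P [-> | /out h] nu;
  rewrite mem_undup mem_cat negb_or => /andP [nt nt']; [exact: out' | exact: h].
Qed.

Lemma expansion_recurrence : solves_recurrence beta p g.
Proof.
move=> mu nu neq; have nz : p nu - p mu != 0.
  by apply: contraNneq neq => /subr0_eq /p_inj ->.
pose A la := la :: rook_above la.
have uA la : uniq (A la) by rewrite /= rook_above_uniq mem_rook_above /rooks eqxx andbF.
have [t0 [ut0 out0]] := common_support (A mu).
(* [t0] carries g ka for all ka in [A mu]; adding the rook extensions of its members gives a finite
   set carrying both expansions. *)
pose t := undup (t0 ++ flatten [seq A eta | eta <- t0]).
have ut : uniq t by apply: undup_uniq.
have in_t0 la : la \in t0 -> la \in t by move=> h; rewrite mem_undup mem_cat h.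
have in_tA la eta : eta \in t0 -> la \in A eta -> la \in t.
  by move=> h1 h2; rewrite mem_undup mem_cat; apply/orP/or_intror/flatten_mapP; exists eta.
(* Both are the coefficient of G_la in P Pi G_mu: [up] applies the Pieri rule before expanding by P,
   [down] after. *)
pose up la := p mu * \sum_(ka <- A mu) beta ^+ skew_size ka mu * g ka la.
pose down la := \sum_(eta <- t0 | la \in A eta)
  p eta * beta ^+ skew_size la eta * g mu eta.
have A_mu : mu \in A mu by rewrite mem_head.
have c0 la : up la - down la = 0.
  apply: (@values_independent t (fun la => up la - down la)) => // {}la.
    move=> nt; rewrite /up /down big_seq big1 => [|ka ka_mu]; last first.
      by rewrite (out0 ka) ?mulr0 //; apply: contra nt; apply: in_t0.
    rewrite mulr0 big_seq_cond big1 ?subr0 // => eta /andP [eta_t0 la_eta].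
    by case/negP: nt; apply: in_tA la_eta.
  under eq_bigr do rewrite mulrBl.
  rewrite sumrB; apply/eqP; rewrite subr_eq0; apply/eqP.
  transitivity (f la * (p la * V mu la)).
    rewrite V_pieri mulrCA mulr_sumr.
    transitivity (p mu *
      \sum_(nu <- t) \sum_(ka <- A mu) beta ^+ skew_size ka mu * g ka nu * V nu la).
      by rewrite mulr_sumr; apply: eq_bigr => ka _; rewrite /up -mulrA mulr_suml.
    congr (_ * _); rewrite exchange_big /= !big_seq; apply: eq_bigr => ka ka_mu.
    rewrite mulrCA (@expansion_on ka t) // => [|x nt]; last first.
      by apply: out0 => //; apply: contra nt; apply: in_t0.
    by rewrite mulr_sumr; apply: eq_bigr => x _; rewrite mulrA.
  rewrite mulrCA (@expansion_on mu t0) // => [|x nt]; last exact: out0 nt.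
  rewrite mulr_sumr.
  under [RHS]eq_bigr => x _ do rewrite /down big_mkcond mulr_suml.
  rewrite exchange_big /= !big_seq; apply: eq_bigr => eta eta_t0.
  rewrite mulrCA V_pieri.
  transitivity (\sum_(x <- A eta) p eta * beta ^+ skew_size x eta * g mu eta * V x la).
    by rewrite !mulr_sumr; apply: eq_bigr => x _; ring.
  transitivity (\sum_(x <- A eta)
    (if x \in A eta then p eta * beta ^+ skew_size x eta * g mu eta else 0) * V x la).
    by rewrite !big_seq; apply: eq_bigr => x ->.
  apply: eq_big_support => // x; first by move=> /negbTE ->; rewrite mul0r.
  by move=> nt xA; case/negP: nt; apply: in_tA xA.
have upE : up nu = p mu * g mu nu +
    \sum_(la <- rook_above mu) p mu * beta ^+ skew_size la mu * g la nu.
  rewrite /up big_cons mulrDr skew_size_refl mul1r mulr_sumr; congr (_ + _).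
  by apply: eq_bigr => la _; rewrite mulrA.
have downE : down nu = p nu * g mu nu +
    \sum_(eta <- rook_below nu) p eta * beta ^+ skew_size nu eta * g mu eta.
  transitivity (\sum_(eta <- nu :: rook_below nu) p eta * beta ^+ skew_size nu eta * g mu eta).
    have memA eta : (nu \in A eta) = (eta \in nu :: rook_below nu).
      rewrite mem_rook_cons inE mem_rook_below /rooks.
      by case: eqP => [->|]; rewrite ?andbT // -mem_rook_cons mem_head.
    rewrite /down -big_filter; apply: eq_big_support.
    - exact: filter_uniq.
    - by rewrite /= rook_below_uniq mem_rook_below /rooks eqxx andbF.
    - move=> x; rewrite mem_filter memA => nt xb; rewrite xb /= in nt.
      by rewrite (out0 mu) ?mulr0.
    - by move=> x nt; rewrite mem_filter memA (negbTE nt).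
  by rewrite big_cons skew_size_refl mulr1.
apply: (mulfI nz); rewrite mulVKf //.
(* The trivial strips contribute p mu * g mu nu and p nu * g mu nu; their difference produces the
   denominator. *)
have /eqP := c0 nu; rewrite subr_eq0 upE downE => /eqP e.
by rewrite mulrBl; apply: (addrI (p mu * g mu nu)); rewrite [RHS]addrA e; ring.
Qed.

End Expansion.

Lemma meval_rev_apoint (K : fieldType) n (beta : K) a (P : {mpoly K[n]}) (la : part n) :
  P \is symmetric -> P.@[rev_apoint beta a la] = P.@[apoint beta a la].
Proof.
move=> /issymP /(_ (perm rev_ord_inj)) {1}<-; rewrite /msym (mmapE (msize P)) // rmorph_sum /=.
rewrite [RHS](mmapE (msize P)) //; apply: eq_bigr => m _; rewrite rmorphM /= mevalC; congr (_ * _).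
rewrite rmorph_prod /=; apply: eq_bigr => i _; rewrite rmorphXn /= mevalXU.
by rewrite /rev_apoint permE rev_ordK.
Qed.

Lemma avar_inj (F : fieldType) i j : (0 < i)%N -> (0 < j)%N ->
  avar i = avar j :> ratfun F -> i = j.
Proof.
move=> i_gt0 j_gt0 e; apply/eqP/negPn/negP => ne.
have /eqP := @prod_beta_avar_neq F 1 (fun=> i) (fun=> j) ord0
  (fun=> i_gt0) (fun=> j_gt0) (fun=> ne).
apply; apply: eq_bigr => k _; exact: (congr1 (fun c => 1 + betavar * c) e).
Qed.

(** With beta = 0 all factors 1 + beta a_j would be 1, against the inequality of products already in
    the one-variable case. *)
Lemma betavar_neq0 (F : fieldType) : betavar != 0 :> ratfun F.
Proof.
apply/eqP => beta0; have /eqP := @prod_beta_avar_neq F 1 (fun=> 1%N) (fun=> 2) ord0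
  (fun=> isT) (fun=> isT) (fun=> isT).
have e k : 1 + betavar * avar k = 1 :> ratfun F.
  exact: (etrans (congr1 (fun c => 1 + c * avar k) beta0)
    (etrans (congr1 (fun c => 1 + c) (mul0r _)) (addr0 _))).
apply; apply: eq_bigr => k _; exact: etrans (e 1%N) (esym (e 2)).
Qed.

Theorem proposition5p2 (F : fieldType) (n : nat) (n_gt0 : (0 < n)%N)
    (P : {mpoly (ratfun F)[n]}) (P_sym : P \is symmetric) :
  let beta : ratfun F := betavar in
  let a : nat -> ratfun F := avar in
  (forall g : part n -> part n -> ratfun F,
     expansion_coefs beta a P g ->
     [/\ recurrence beta a g, boundary beta a P g
       & forall mu nu, g mu nu = chain_formula beta a P mu nu]) /\
  (forall g : part n -> part n -> ratfun F,
     recurrence beta a g /\ boundary beta a P g <->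
     forall mu nu, g mu nu = chain_formula beta a P mu nu).
Proof.
move=> beta a.
have beta_neq0 : beta != 0 by apply: betavar_neq0.
have a_neq0 j : (0 < j)%N -> 1 + beta * a j != 0 by apply: beta_avar_neq0.
have a_inj i j : (0 < i)%N -> (0 < j)%N -> a i = a j -> i = j.
  exact: avar_inj.
pose p (la : part n) := Pi beta (apoint beta a la).
pose f (la : part n) := P.@[apoint beta a la].
have p_inj : injective p.
  by move=> la mu /eqP; apply: contraTeq; apply: Pi_apoint_neq.
(* The two sides are convertible: [node] and [divdiff] only name pieces of the formula. *)
have formulaE mu nu : chain_formula beta a P mu nu = chain_solution beta p f mu nu by [].
have solved g : recurrence beta a g /\ boundary beta a P g <->
    forall mu nu, g mu nu = chain_formula beta a P mu nu.
  have sol_rec : solves_recurrence beta p (chain_solution beta p f).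
    exact: chain_solution_recurrence.
  have sol_bd : solves_boundary f (chain_solution beta p f).
    exact: chain_solution_boundary.
  split=> [[rg bg] mu nu | eg].
    rewrite formulaE; exact: (recurrence_unique rg bg sol_rec sol_bd).
  have [sol0 solf] := sol_bd; split; last first.
    by split=> [mu nu /sol0 | la]; rewrite eg formulaE // solf.
  move=> mu nu neq; rewrite eg formulaE sol_rec //.
  by congr (_ * (_ - _)); apply: eq_bigr => la _; rewrite eg formulaE.
split=> // g g_exp.
have g_val mu : exists s : seq (part n),
  [/\ uniq s, forall nu, nu \notin s -> g mu nu = 0
    & forall ka, f ka * dual_value beta a mu ka = \sum_(nu <- s) g mu nu * dual_value beta a nu ka].
  have [s [us out e]] := g_exp mu; exists s; split=> // ka.
  rewrite /f -(meval_rev_apoint beta a ka P_sym) -mevalM e raddf_sum /=.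
  by apply: eq_bigr => nu _; rewrite mevalZ.
have V_sub := @dual_value_vanish _ n _ _ beta_neq0 a_neq0.
have V_diag := @dual_value_diag _ n _ _ beta_neq0 a_neq0 a_inj.
have rg : recurrence beta a g.
  exact: (expansion_recurrence p_inj V_sub V_diag
    (dual_value_pieri beta_neq0 a_neq0) g_val).
have bg : boundary beta a P g by exact: (expansion_boundary V_sub V_diag g_val).
by split=> //; apply/solved.
Qed.
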